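(* Let $(A,\mathfrak{m})$ be a commutative Noetherian local ring, let $M$ be a non-zero finitely generated $A$-module and let $I \neq A$ be an ideal of $A$. Then there exists a non-negative integer $r_I^M$, depending only on $I$ and $M$, such that for every non-zero object $X_\bullet$ of $K^b_f(\operatorname{proj} A)$ the function of polynomial type $$\psi_{X_\bullet}^{M,I}(n) = \sum_{i\in\mathbb{Z}} \ell\big(H^i(X_\bullet\otimes_A M/I^nM)\big), \qquad n\geq 1,$$ has degree $r_I^M(X_\bullet)=r_I^M$.
   Context: $\ell(T)$ denotes the length of an $A$-module $T$ of finite length. $K^b(\operatorname{proj} A)$ is the homotopy category of bounded complexes of finitely generated projective $A$-modules (complexes indexed cohomologically), and $K^b_f(\operatorname{proj} A)$ is its full subcategory of complexes all of whose cohomology modules have finite length. An object is non-zero if it is not isomorphic to $0$ in the homotopy category, equivalently its cohomology is not identically zero. For $X_\bullet\in K^b_f(\operatorname{proj} A)$ all modules $H^i(X_\bullet\otimes_A M/I^nM)$ have finite length. A function $f:\mathbb{Z}_{\ge 1}\to\mathbb{Z}$ is of polynomial type if there is a polynomial $p\in\mathbb{Q}[t]$ with $f(n)=p(n)$ for all $n\gg 0$; its degree is the degree of $p$. It is known that $\psi_{X_\bullet}^{M,I}$ is of polynomial type; its degree is denoted $r_I^M(X_\bullet)$. *)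

(* Defs.v *)
From HB Require Import structures.
From mathcomp Require Import all_boot all_order all_algebra.
From mathcomp Require Import generic_quotient ring_quotient.
From mathcomp Require Import boolp classical_sets fsbigop.
From mathcomp Require Import freeg.

Set Implicit Arguments.
Unset Strict Implicit.
Unset Printing Implicit Defensive.

Import Order.TTheory GRing.Theory Num.Theory.
Local Open Scope classical_set_scope.
Local Open Scope ring_scope.
Local Open Scope quotient_scope.

(* Submodules are [submodClosed V]; they are compared with [=i] and
   [{subset _ <= _}]. Ideals of [A] are the submodules of the regular
   module [A^o]. *)

Section Span.
Variables (A : comNzRingType) (V : lmodType A) (G : set V).

Definition submod_span : V -> bool := fun x =>
  `[< forall S : submodClosed V, (forall y, G y -> y \in S) -> x \in S >].

Fact span_submod_closed : subsemimod_closed submod_span.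
Proof.
split; first split.
- by apply/asboolP => S _; exact: rpred0.
- move=> x y /asboolP hx /asboolP hy; apply/asboolP => S hS.
  by apply: rpredD; [exact: hx|exact: hy].
- move=> a x /asboolP hx; apply/asboolP => S hS.
  by apply: rpredZ; exact: hx.
Qed.

HB.instance Definition _ :=
  GRing.isSubmodClosed.Build A V submod_span span_submod_closed.

End Span.

Definition fin_gen (A : comNzRingType) (V : lmodType A) : Prop :=
  exists s : seq V, submod_span [set` s] =i predT.

Definition noetherian (A : comNzRingType) : Prop :=
  forall J : submodClosed A^o, exists s : seq A^o, J =i submod_span [set` s].

Definition maximal_ideal (A : comNzRingType) (m : submodClosed A^o) : Prop :=
  ~ (m =i predT) /\
  forall J : submodClosed A^o, {subset m <= J} -> J =i m \/ J =i predT.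

Definition local_ring (A : comNzRingType) (m : submodClosed A^o) : Prop :=
  maximal_ideal m /\
  forall m' : submodClosed A^o, maximal_ideal m' -> m' =i m.

Definition projective (A : comNzRingType) (P : lmodType A) : Prop :=
  forall (U W : lmodType A) (g : {linear U -> W}) (f : {linear P -> W}),
    (forall w, exists u, g u = w) ->
    exists h : {linear P -> U}, forall x, g (h x) = f x.

(* [quomod G] is V / <G>, the quotient by the submodule generated by G. *)
Section QuotientModule.
Variables (A : comNzRingType) (V : lmodType A) (G : set V).

Local Notation QG :=
  (Quotient.quot (GRing.ZmodClosed.clone V (submod_span G) _)).

Definition quomod : Type := QG.

HB.instance Definition _ := GRing.Zmodule.on quomod.

Definition quo_pi (x : V) : quomod := \pi_QG x.

Definition quo_repr (u : quomod) : V := repr (u : QG).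

Fact quo_reprK : cancel quo_repr quo_pi.
Proof. by move=> u; rewrite /quo_pi /quo_repr reprK. Qed.

Fact quo_piP x y : quo_pi x = quo_pi y <-> x - y \in submod_span G.
Proof. by rewrite Quotient.idealrBE; split=> /eqP. Qed.

Fact quo_piD : {morph quo_pi : x y / x + y}.
Proof. by move=> x y; exact: raddfD. Qed.

Definition quo_scale (a : A) (u : quomod) : quomod := quo_pi (a *: quo_repr u).

Fact quo_piZ a x : quo_scale a (quo_pi x) = quo_pi (a *: x).
Proof.
apply/quo_piP; rewrite -scalerBr rpredZ //; apply/quo_piP.
exact: quo_reprK.
Qed.

Fact quo_scaleA a b u : quo_scale a (quo_scale b u) = quo_scale (a * b) u.
Proof. by rewrite -(quo_reprK u) !quo_piZ scalerA. Qed.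

Fact quo_scale1 : left_id 1 quo_scale.
Proof. by move=> u; rewrite -(quo_reprK u) quo_piZ scale1r. Qed.

Fact quo_scaleDr : right_distributive quo_scale +%R.
Proof.
move=> a u v; rewrite -(quo_reprK u) -(quo_reprK v).
by rewrite -quo_piD !quo_piZ -quo_piD scalerDr.
Qed.

Fact quo_scaleDl u : {morph quo_scale^~ u : a b / a + b}.
Proof.
by move=> a b; rewrite -(quo_reprK u) !quo_piZ -quo_piD scalerDl.
Qed.

HB.instance Definition _ := GRing.Zmodule_isLmodule.Build A quomod
  quo_scaleA quo_scale1 quo_scaleDr quo_scaleDl.

Fact quo_pi_is_linear : linear quo_pi.
Proof. by move=> a x y; rewrite quo_piD -quo_piZ. Qed.

HB.instance Definition _ :=
  GRing.isLinear.Build A V quomod _ quo_pi quo_pi_is_linear.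

End QuotientModule.

Section Kernel.
Variables (A : comNzRingType) (V W : lmodType A) (f : {linear V -> W}).

Definition ker_pred : V -> bool := fun x => f x == 0.

Fact ker_submod_closed : subsemimod_closed ker_pred.
Proof.
split; first split; rewrite /ker_pred.
- by rewrite unfold_in linear0.
- by move=> x y; rewrite !unfold_in linearD => /eqP -> /eqP ->; rewrite addr0.
- by move=> a x; rewrite !unfold_in linearZ /= => /eqP ->; rewrite scaler0.
Qed.

HB.instance Definition _ :=
  GRing.isSubmodClosed.Build A V ker_pred ker_submod_closed.

Definition kermod : Type := {x : V | ker_pred x}.

HB.instance Definition _ := SubChoice.on kermod.
HB.instance Definition _ := [SubChoice_isSubLmodule of kermod by <:].

End Kernel.

(* M (x)_A N, as the free module on M * N modulo the bilinearity relations. *)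
Section Tensor.
Variables (A : comNzRingType) (M N : lmodType A).

Local Notation F := {freeg (M * N) / A}.
Local Notation e m n := (<< (m, n) >> : F).

Definition bilin_rel : set F := [set z |
  [\/ exists m1 m2 n, z = e (m1 + m2) n - (e m1 n + e m2 n),
      exists m n1 n2, z = e m (n1 + n2) - (e m n1 + e m n2),
      exists a m n, z = e (a *: m) n - a *: e m n
    | exists a m n, z = e m (a *: n) - a *: e m n]].

Definition tensor : Type := quomod bilin_rel.

HB.instance Definition _ := GRing.Lmodule.on tensor.

Definition tens (m : M) (n : N) : tensor := quo_pi bilin_rel (e m n).

Fact tens_rel0 z : bilin_rel z -> quo_pi bilin_rel z = 0.
Proof.
move=> hz; rewrite -(linear0 (quo_pi bilin_rel)); apply/quo_piP.
by rewrite subr0; apply/asboolP => S; apply.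
Qed.

Fact tensDl m1 m2 n : tens (m1 + m2) n = tens m1 n + tens m2 n.
Proof.
apply/eqP; rewrite -subr_eq0 -!linearD -linearB /=; apply/eqP.
by apply: tens_rel0; constructor 1; exists m1, m2, n.
Qed.

Fact tensDr m n1 n2 : tens m (n1 + n2) = tens m n1 + tens m n2.
Proof.
apply/eqP; rewrite -subr_eq0 -!linearD -linearB /=; apply/eqP.
by apply: tens_rel0; constructor 2; exists m, n1, n2.
Qed.

Fact tensZl a m n : tens (a *: m) n = a *: tens m n.
Proof.
apply/eqP; rewrite -subr_eq0 -linearZ -linearB /=; apply/eqP.
by apply: tens_rel0; constructor 3; exists a, m, n.
Qed.

Fact tensZr a m n : tens m (a *: n) = a *: tens m n.
Proof.
apply/eqP; rewrite -subr_eq0 -linearZ -linearB /=; apply/eqP.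
by apply: tens_rel0; constructor 4; exists a, m, n.
Qed.

End Tensor.

(* f (x) id_N *)
Section TensorMap.
Variables (A : comNzRingType) (M M' N : lmodType A) (f : {linear M -> M'}).

Definition free_map (z : {freeg (M * N) / A}) : tensor M' N :=
  fglift (fun p : M * N => tens (f p.1) p.2) z.

Fact free_map_is_linear : linear free_map.
Proof.
have addB := @lift_is_additive A (M * N)%type (tensor M' N)
  (fun p => tens (f p.1) p.2).
have add0 : free_map 0 = 0 by have := addB 0 0; rewrite /free_map !subrr.
have addN z : free_map (- z) = - free_map z.
  have := addB 0 z; rewrite /free_map !sub0r => ->.
  by rewrite [fglift _ 0]add0 sub0r.
have addD z t : free_map (z + t) = free_map z + free_map t.
  by rewrite -[t in LHS]opprK [LHS]addB [X in _ - X]addN opprK.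
have sumE (s : seq (M * N)) (g : M * N -> {freeg (M * N) / A}) :
    free_map (\sum_(p <- s) g p) = \sum_(p <- s) free_map (g p).
  by elim/big_rec2: _ => // p z t _ <-; rewrite addD.
move=> a z t; rewrite addD; congr (_ + _).
rewrite -{2}(freeg_sumE z) [a *: z]/GRing.scale /= /fgscale !sumE scaler_sumr.
by apply: eq_bigr => p _; rewrite /free_map !liftU scalerA.
Qed.

HB.instance Definition _ := GRing.isLinear.Build A {freeg (M * N) / A}
  (tensor M' N) _ free_map free_map_is_linear.

Fact free_map_rel0 z : z \in submod_span (@bilin_rel A M N) -> free_map z = 0.
Proof.
move=> /asboolP h.
apply/eqP; apply: (h (GRing.SubmodClosed.clone A _ (ker_pred free_map) _)).
move=> {h}z.
have E m n : free_map << (m, n) >> = tens (f m) n.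
  by rewrite /free_map liftU scale1r.
case=> -[x [y [w ->]]]; apply/eqP; rewrite (linearB free_map).
- by rewrite (linearD free_map) /= !E (linearD f) tensDl subrr.
- by rewrite (linearD free_map) /= !E tensDr subrr.
- by rewrite (linearZ_LR free_map) /= !E (linearZ_LR f) tensZl subrr.
- by rewrite (linearZ_LR free_map) /= !E tensZr subrr.
Qed.

Definition tensor_map (u : tensor M N) : tensor M' N := free_map (quo_repr u).

Fact tensor_map_pi z : tensor_map (quo_pi _ z) = free_map z.
Proof.
apply/eqP; rewrite -subr_eq0 -linearB /=; apply/eqP/free_map_rel0.
by apply/quo_piP; exact: quo_reprK.
Qed.

Fact tensor_mapE m n : tensor_map (tens m n) = tens (f m) n.
Proof. by rewrite tensor_map_pi /free_map liftU scale1r. Qed.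

Fact tensor_map_is_linear : linear tensor_map.
Proof.
move=> a u v; rewrite -(quo_reprK u) -(quo_reprK v).
by rewrite -linearP !tensor_map_pi linearP.
Qed.

HB.instance Definition _ := GRing.isLinear.Build A (tensor M N)
  (tensor M' N) _ tensor_map tensor_map_is_linear.

End TensorMap.

Fact tensor_ind (A : comNzRingType) (M N : lmodType A)
    (P : tensor M N -> Prop) :
  P 0 -> (forall u v, P u -> P v -> P (u + v)) ->
  (forall a m n, P (a *: tens m n)) -> forall u, P u.
Proof.
move=> P0 PD Pt u; rewrite -(quo_reprK u) -(freeg_sumE (quo_repr u)).
rewrite linear_sum; elim/big_ind: _ => // -[m n] _ /=.
suff -> : << coeff (m, n) (quo_repr u) *g (m, n) >> =
          coeff (m, n) (quo_repr u) *: << (m, n) >> :> {freeg (M * N) / A}.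
  by rewrite linearZ; exact: Pt.
by apply/eqP/freeg_eqP => x; rewrite coeffZ !coeffU mul1r.
Qed.

(* Cochain complexes. The differential is a doubly indexed family, zero
   outside the places (i, i + 1), so that no transport along an equality of
   indices is needed. *)
Record complex (A : comNzRingType) := Complex {
  cobj :> int -> lmodType A;
  cdiff : forall i j, {linear cobj i -> cobj j};
  cdiff_shape : forall i j, j != i + 1 -> forall x, cdiff i j x = 0;
  cdiffK : forall i j k x, cdiff j k (cdiff i j x) = 0
}.

Section Cohomology.
Variables (A : comNzRingType) (X : complex A) (i : int).

Definition cocycles : lmodType A := kermod (cdiff X i (i + 1)).

Definition coboundaries : set cocycles :=
  [set z | exists y : X (i - 1), \val (z : kermod _) = cdiff X (i - 1) i y].

Definition cohomology : lmodType A := quomod coboundaries.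

End Cohomology.

Section TensorComplex.
Variables (A : comNzRingType) (X : complex A) (N : lmodType A).

Definition tcobj (i : int) : lmodType A := tensor (X i) N.

Definition tcdiff (i j : int) : {linear tcobj i -> tcobj j} :=
  @tensor_map A (X i) (X j) N (cdiff X i j).

Fact tcdiff_shape i j : j != i + 1 -> forall x, tcdiff i j x = 0.
Proof.
move=> ij; apply: tensor_ind => [|u v hu hv|a m n].
- exact: linear0.
- by rewrite linearD hu hv addr0.
- rewrite linearZ /= tensor_mapE cdiff_shape //.
  by rewrite -(scale0r 0) tensZl !scale0r scaler0.
Qed.

Fact tcdiffK i j k x : tcdiff j k (tcdiff i j x) = 0.
Proof.
elim/tensor_ind: x => [|u v hu hv|a m n].
- by rewrite !linear0.
- by rewrite !linearD hu hv addr0.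
- rewrite !linearZ /= !tensor_mapE cdiffK.
  by rewrite -(scale0r 0) tensZl !scale0r scaler0.
Qed.

Definition tensor_complex : complex A := Complex tcdiff_shape tcdiffK.

End TensorComplex.

Section Homotopy.
Variable A : comNzRingType.

Record chain_map (X Y : complex A) := ChainMap {
  cmap :> forall i, {linear X i -> Y i};
  cmap_comm : forall i j x, cmap j (cdiff X i j x) = cdiff Y i j (cmap i x)
}.

(* Only the components h i (i - 1) of a homotopy are used. *)
Definition homotopic (X Y : complex A) (f g : forall i, X i -> Y i) : Prop :=
  exists h : forall i j, {linear X i -> Y j}, forall i x,
    f i x - g i x = cdiff Y (i - 1) i (h i (i - 1) x)
                    + h (i + 1) i (cdiff X i (i + 1) x).

Definition homotopy_iso (X Y : complex A) : Prop :=
  exists (f : chain_map X Y) (g : chain_map Y X),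
    @homotopic X X (fun i x => g i (f i x)) (fun i x => x) /\
    @homotopic Y Y (fun i y => f i (g i y)) (fun i y => y).

Definition zero_obj (i : int) : lmodType A := 'rV[A]_0.

Definition zero_diff (i j : int) : {linear zero_obj i -> zero_obj j} :=
  GRing.null_fun 'rV[A]_0.

Definition zero_complex : complex A :=
  @Complex A zero_obj zero_diff (fun _ _ _ _ => erefl) (fun _ _ _ _ => erefl).

End Homotopy.

Section Length.
Variables (A : comNzRingType) (T : lmodType A).

Definition strict_chain (n : nat) : Prop :=
  exists S : nat -> submodClosed T, forall i, (i < n)%N ->
    {subset S i <= S i.+1} /\ ~ (S i =i S i.+1).

(* The supremum of the lengths of strict chains is attained and equal to n. *)
Definition is_length (n : nat) : Prop :=
  strict_chain n /\ forall k, strict_chain k -> (k <= n)%N.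

Definition finite_length : Prop := exists n, is_length n.

(* Meaningful only when [finite_length] holds; otherwise 0. *)
Definition mod_length : nat := xget 0%N [set n | is_length n].

End Length.

Section Perfect.
Variables (A : comNzRingType) (X : complex A).

Definition bounded : Prop :=
  exists b : int, forall i, b < `|i| -> forall x : X i, x = 0.

Definition Kb_proj : Prop :=
  bounded /\ forall i, fin_gen (X i) /\ projective (X i).

Definition Kbf_proj : Prop :=
  Kb_proj /\ forall i, finite_length (cohomology X i).

End Perfect.

Section Psi.
Variables (A : comNzRingType).

Fixpoint ideal_exp (I : {pred A^o}) (n : nat) : A^o -> bool :=
  if n is n'.+1 then
    submod_span [set c : A^o | exists a b : A,
      [/\ a \in I, b \in ideal_exp I n' & c = a * b]]
  else predT.

Definition quo_exp (M : lmodType A) (I : {pred A^o}) (n : nat) : lmodType A :=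
  quomod [set z : M | exists a x, a \in ideal_exp I n /\ z = a *: x].

(* The sum over Z is the sum over the support, which is finite for bounded X. *)
Definition psi (M : lmodType A) (I : {pred A^o}) (X : complex A) (n : nat)
    : nat :=
  \sum_(i \in [set: int])
    mod_length (cohomology (tensor_complex X (quo_exp M I n)) i).

End Psi.

Definition polynomial_type_deg (f : nat -> int) (r : nat) : Prop :=
  exists p : {poly rat}, size p = r.+1 /\
    exists n0 : nat, forall n : nat, (n0 <= n)%N -> (f n)%:~R = p.[n%:R].

(* Main.v *)
From HB Require Import structures.
Require Import Defs.
From mathcomp Require Import all_boot all_order all_algebra.
From mathcomp Require Import boolp classical_sets fsbigop.
From mathcomp Require Import freeg.
From mathcomp Require Import zify ring.

Set Implicit Arguments.
Unset Strict Implicit.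
Unset Printing Implicit Defensive.

Import Order.TTheory GRing.Theory Num.Theory.
Local Open Scope classical_set_scope.
Local Open Scope ring_scope.

(** The degree is independent of the complex because, for two non-zero objects [X]
    and [Y] of K^b_f(proj A), [psi_Y <= K psi_X] for a constant [K]: then two
    functions of polynomial type bound each other.

    The inequality holds more generally: for every quotient [N] of [M], with [h
    T] the largest length of a cohomology module of [X (x) T], the lengths of
    the modules [H^q(Y (x) N)] are at most [K h N] with [K] independent of [N].
    The functor [h] has three properties. It is subadditive along the long
    exact sequences of [X], whose terms are free; [h T] is at most a constant
    times the length of [T]; and the length of [T / m T] is at most [h T],
    because [X], being non-zero, has a cocycle [x] and a cochain map [lam : X
    -> A/m] with [lam x = 1] ([cocycle_outside], [coh_le_residue]). Now go down
    from the top degree of [Y (x) N], writing [C], [B], [H] for cocycles,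
    coboundaries and cohomology. In degree [q + 1], a bound on the length of
    [H] and on [h C] bounds [h B]; as [B] is [Y^q (x) N] modulo the cocycles of
    degree [q], this bounds [h C] in degree [q], hence the length of [C / m C]
    and of [H / m H], and finally that of [H]: a power of each generator of [m]
    is null-homotopic on [Y], so it kills [H] whatever [N] is
    ([nilpotent_cohomology], [lenle_nilpotents]). This is [comparison].

    That [psi] is of polynomial type is a Hilbert function argument. With
    [F = X (x) M], the length of the cohomology of [F / I^n F] is the sum of a
    term that is eventually constant and of the length of
    [(I^n F :&: d F) / d (I^n F)], a graded piece of a subquotient of the Rees
    module of [F] ([hlen_evpoly]). The latter lengths are eventually polynomial by
    [hilbert_function], where finite generation comes from [artin_rees].
    By the third property of [h] and Nakayama's lemma [psi] is not eventually
    zero, so it has a degree ([psi_pos]).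

    The lengths of the cohomology modules of [X (x) M/I^n M] are computed as
    lengths of intervals of submodules in finite powers of [M], which is what
    tensor products with free modules become in coordinates. *)

(** * Submodules and lengths of intervals of submodules *)

Definition submod (A : comNzRingType) (V : lmodType A) (S : set V) : Prop :=
  [/\ S 0, forall x y, S x -> S y -> S (x + y)
    & forall a x, S x -> S (a *: x)].

Definition addS (A : comNzRingType) (V : lmodType A) (P Q : set V) : set V :=
  [set z | exists x y, [/\ P x, Q y & z = x + y]].

Definition mulS (A : comNzRingType) (V : lmodType A) (c : A) (P : set V) :
  set V := [set z | exists2 x, P x & z = c *: x].

Section Submodules.
Variables (A : comNzRingType) (V : lmodType A).
Implicit Types (P Q R S : set V).

Lemma submod0 S : submod S -> S 0. Proof. by case. Qed.

Lemma submodD S x y : submod S -> S x -> S y -> S (x + y).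
Proof. by case=> _ h _; exact: h. Qed.

Lemma submodZ S a x : submod S -> S x -> S (a *: x).
Proof. by case=> _ _ h; exact: h. Qed.

Lemma submodN S x : submod S -> S x -> S (- x).
Proof. by move=> hS hx; rewrite -scaleN1r; exact: submodZ. Qed.

Lemma submodB S x y : submod S -> S x -> S y -> S (x - y).
Proof. by move=> hS hx hy; apply: submodD => //; exact: submodN. Qed.

Lemma submodBr S x y : submod S -> S x -> S (y - x) -> S y.
Proof. by move=> hS hx hy; rewrite -(subrK x y); exact: submodD. Qed.

Lemma submod_sum S (I : Type) (r : seq I) (p : pred I) (F : I -> V) :
  submod S -> (forall i, p i -> S (F i)) -> S (\sum_(i <- r | p i) F i).
Proof.
move=> hS h; elim/big_ind: _ => //; first exact: submod0.
by move=> x y; exact: submodD.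
Qed.

Lemma submod_set0 : submod [set (0 : V)].
Proof.
split=> //= [x y -> ->|a x ->]; first by rewrite addr0.
by rewrite scaler0.
Qed.

Lemma submodT : submod [set: V]. Proof. by []. Qed.

Lemma submodI P Q : submod P -> submod Q -> submod (P `&` Q).
Proof.
move=> hP hQ; split; first by split; exact: submod0.
- by move=> x y [? ?] [? ?]; split; exact: submodD.
- by move=> a x [? ?]; split; exact: submodZ.
Qed.

Lemma submod_addS P Q : submod P -> submod Q -> submod (addS P Q).
Proof.
move=> hP hQ; split.
- by exists 0, 0; rewrite addr0; split => //; exact: submod0.
- move=> _ _ [x [y [Px Qy ->]]] [x' [y' [Px' Qy' ->]]].
  by exists (x + x'), (y + y'); rewrite addrACA; split => //; exact: submodD.
- move=> a _ [x [y [Px Qy ->]]]; exists (a *: x), (a *: y).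
  by rewrite scalerDr; split => //; exact: submodZ.
Qed.

Lemma addSl P Q : submod Q -> P `<=` addS P Q.
Proof. by move=> hQ x Px; exists x, 0; rewrite addr0; split=> //; exact: submod0. Qed.

Lemma addSr P Q : submod P -> Q `<=` addS P Q.
Proof. by move=> hP x Px; exists 0, x; rewrite add0r; split=> //; exact: submod0. Qed.

Lemma addS_sub P Q R : submod R -> P `<=` R -> Q `<=` R -> addS P Q `<=` R.
Proof.
by move=> hR PR QR _ [x [y [/PR Rx /QR Ry ->]]]; exact: submodD.
Qed.

Lemma addS_mono P P' Q Q' :
  P `<=` P' -> Q `<=` Q' -> addS P Q `<=` addS P' Q'.
Proof.
by move=> hP hQ _ [x [y [/hP Px /hQ Qy ->]]]; exists x, y.
Qed.

Lemma submod_mulS c P : submod P -> submod (mulS c P).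
Proof.
move=> hP; split.
- by exists 0; [exact: submod0|rewrite scaler0].
- move=> _ _ [x Px ->] [y Py ->]; exists (x + y); first exact: submodD.
  by rewrite scalerDr.
- move=> a _ [x Px ->]; exists (a *: x); first exact: submodZ.
  by rewrite !scalerA mulrC.
Qed.

Lemma mulS_sub c P : submod P -> mulS c P `<=` P.
Proof. by move=> hP _ [x Px ->]; exact: submodZ. Qed.

End Submodules.

Section LinearSubmodules.
Variables (A : comNzRingType) (V W : lmodType A) (f : {linear V -> W}).

Lemma submod_image (P : set V) : submod P -> submod (f @` P).
Proof.
move=> hP; split.
- by exists 0; [exact: submod0|rewrite linear0].
- move=> _ _ [x Px <-] [y Py <-]; exists (x + y); first exact: submodD.
  by rewrite linearD.
- move=> a _ [x Px <-]; exists (a *: x); first exact: submodZ.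
  by rewrite linearZ.
Qed.

Lemma submod_preimage (P : set W) : submod P -> submod (f @^-1` P).
Proof.
move=> hP; split; rewrite /preimage /=.
- by rewrite linear0; exact: submod0.
- by move=> x y Px Py; rewrite linearD; exact: submodD.
- by move=> a x Px; rewrite linearZ; exact: submodZ.
Qed.

End LinearSubmodules.

Section Length.
Variables (A : comNzRingType) (V : lmodType A).
Implicit Types (P Q R : set V) (S T : nat -> set V).

Definition between Q P (U : set V) : Prop := [/\ submod U, Q `<=` U & U `<=` P].

Definition chain Q P (k : nat) : Prop := exists S,
  (forall i, (i <= k)%N -> between Q P (S i)) /\
  (forall i, (i < k)%N -> S i `<=` S i.+1 /\ ~ (S i.+1 `<=` S i)).

Definition lenle Q P (n : nat) : Prop := forall k, chain Q P k -> (k <= n)%N.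

(** The default value 0 is the length given to intervals of infinite length. *)
Definition len Q P : nat := xget 0%N [set n | chain Q P n /\ lenle Q P n].

Lemma lenle_leq Q P n n' : (n <= n')%N -> lenle Q P n -> lenle Q P n'.
Proof. by move=> nn' h k /h kn; exact: leq_trans nn'. Qed.

Lemma lenle_sub Q P Q' P' n :
  Q `<=` Q' -> P' `<=` P -> lenle Q P n -> lenle Q' P' n.
Proof.
move=> QQ PP h k [S [hS1 hS2]]; apply: h; exists S; split=> // i /hS1.
by case=> hs qs sp; split=> //; [exact: subset_trans qs|exact: subset_trans PP].
Qed.

Lemma chain0 Q P : submod Q -> Q `<=` P -> chain Q P 0.
Proof. by move=> hQ QP; exists (fun=> Q); split=> // i _; split. Qed.

Lemma lenle0 Q P : P `<=` Q -> lenle Q P 0.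
Proof.
move=> PQ [//|k] [S [hS1 hS2]]; have [_ []] := hS2 0%N erefl.
have [_ _ s1] := hS1 1%N erefl; have [_ s0 _] := hS1 0%N erefl.
by move=> x /s1 /PQ /s0.
Qed.

Lemma lenle0_sub Q P : submod Q -> submod P -> Q `<=` P -> lenle Q P 0 ->
  P `<=` Q.
Proof.
move=> hQ hP QP h; have [//|nPQ] := pselect (P `<=` Q).
suff /h : chain Q P 1 by [].
exists (fun i => if i is 0%N then Q else P); split=> [[|i]|[|i]] // _; split=> //.
Qed.

Lemma lenP Q P n : submod Q -> Q `<=` P -> lenle Q P n ->
  chain Q P (len Q P) /\ lenle Q P (len Q P).
Proof.
move=> hQ QP hn; rewrite /len; case: xgetP => [k -> [] //|no].
suff: exists k, chain Q P k /\ lenle Q P k by case=> k /no.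
elim: n hn => [|n IH] hn.
  by exists 0%N; split=> //; exact: chain0.
have [c|c] := pselect (chain Q P n.+1); first by exists n.+1.
apply: IH => k ck; have := hn k ck; rewrite leq_eqVlt => /orP[/eqP e|//].
by case: c; rewrite -e.
Qed.

Lemma lenleP Q P n : submod Q -> Q `<=` P -> lenle Q P n ->
  lenle Q P (len Q P).
Proof. by move=> hQ QP /lenP[]. Qed.

Lemma len_le Q P n : submod Q -> Q `<=` P -> lenle Q P n -> (len Q P <= n)%N.
Proof. by move=> hQ QP h; have [/h] := lenP hQ QP h. Qed.

Lemma len_eq0 Q P : P `<=` Q -> len Q P = 0%N.
Proof.
move=> PQ; rewrite /len; case: xgetP => [k -> [c _]|//].
by apply/eqP; rewrite -leqn0; exact: lenle0 c.
Qed.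

(** Intersecting the members of a chain with a submodule, or adding one, leaves a
    sequence that is only weakly increasing; this counts its strict steps. *)
Lemma weak_chain Q P S k :
  (forall i, (i <= k)%N -> between Q P (S i)) ->
  (forall i, (i < k)%N -> S i `<=` S i.+1) ->
  chain Q P (\sum_(i < k) `[< ~ (S i.+1 `<=` S i) >]).
Proof.
move=> h1 h2.
suff [T [hT1 [hT2 _]]] : exists T, let c := (\sum_(i < k) `[< ~ (S i.+1 `<=` S i) >])%N in
    (forall i, (i <= c)%N -> between Q P (T i)) /\
    ((forall i, (i < c)%N -> T i `<=` T i.+1 /\ ~ (T i.+1 `<=` T i)) /\
    T c = S k) by exists T.
elim: k h1 h2 => [|k IH] h1 h2.
  by exists S; rewrite big_ord0 /=; split=> //; split.
have [|i|T [hT1 [hT2 Tk]]] := IH; first by move=> i ik; apply: h1; rewrite leqW.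
  by move=> ik; apply: h2; rewrite ltnW.
rewrite big_ord_recr /=; set c := (\sum_(i < k) _)%N in hT1 hT2 Tk *.
have [s|s] := pselect (S k.+1 `<=` S k).
  rewrite (asboolF (fun ns : ~ _ => ns s)) addn0; exists T; split=> //; split=> //.
  by rewrite Tk; apply/seteqP; split=> //; exact: h2.
rewrite (asboolT s) addn1.
exists (fun i => if (i <= c)%N then T i else S k.+1).
split=> [i _|]; first by case: leqP => [ic|_]; [exact: hT1|exact: h1].
split=> [i|]; last by rewrite ltnn.
rewrite ltnS => le_ic; have [->|ic] : i = c \/ (i < c)%N by lia.
  by rewrite leqnn ltnn Tk; split=> //; exact: h2.
by rewrite (ltnW ic) ic; exact: hT2.
Qed.

(** Intersecting with [R] and adding [R] turns a chain from [Q] to [P] into two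
    weakly increasing sequences; by the modular law each strict step stays
    strict in at least one of them. *)
Lemma lenle_add Q R P a b : submod R -> Q `<=` R -> R `<=` P -> submod P ->
  lenle Q R a -> lenle R P b -> lenle Q P (a + b).
Proof.
move=> hR QR RP hP ha hb k [S [h1 h2]].
have c1 : chain Q R (\sum_(i < k) `[< ~ (S i.+1 `&` R `<=` S i `&` R) >]).
  apply: (@weak_chain Q R (fun i => S i `&` R)) => i ik.
    have [s qs sp] := h1 i ik; split; first exact: submodI.
      by move=> x qx; split; auto.
    by move=> x [].
  by have [s _] := h2 i ik; move=> x []; split; auto.
have c2 : chain R P (\sum_(i < k) `[< ~ (addS (S i.+1) R `<=` addS (S i) R) >]).
  apply: (@weak_chain R P (fun i => addS (S i) R)) => i ik.
    have [s qs sp] := h1 i ik; split; first exact: submod_addS.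
      exact: addSr.
    exact: addS_sub.
  by have [s _] := h2 i ik; exact: addS_mono.
apply: leq_trans (leq_add (ha _ c1) (hb _ c2)).
rewrite -big_split /= -{1}(card_ord k) -sum1_card; apply: leq_sum => -[i ik] _ /=.
case: asboolP => [//|/contrapT sI]; case: asboolP => [//|/contrapT sA].
have [s []] := h2 i ik; move=> x xS.
have hS := h1 i (ltnW ik); have hS1 := h1 i.+1 ik.
have [y [z [Sy Rz exyz]]] := sA x (@addSl _ _ _ R hR _ xS).
have Sz : S i.+1 z.
  have -> : z = x - y by rewrite exyz addrC addKr.
  by apply: submodB => //; [case: hS1|exact: s].
have [Sz' _] := sI z (conj Sz Rz).
by rewrite exyz; apply: submodD => //; case: hS.
Qed.

Lemma chain_add Q R P a b : Q `<=` R -> R `<=` P ->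
  chain Q R a -> chain R P b -> chain Q P (a + b).
Proof.
move=> QR RP [S [s1 s2]] [T [t1 t2]].
exists (fun i => if (i <= a)%N then S i else T (i - a)%N); split=> i ik.
  case: leqP => ia; first by have [? ? ?] := s1 i ia; split=> // x ?; auto.
  have [|? ? ?] := t1 (i - a)%N; first by lia.
  by split=> // x ?; auto.
case: (ltngtP i a) => ia.
- exact: s2.
- by rewrite subSn ?(ltnW ia) //; apply: t2; lia.
- rewrite ia subSnn; have [_ _ Sa] := s1 a (leqnn a).
  have [_ R0 _] := t1 0%N (leq0n b); have [|t01 nt] := t2 0%N; first by lia.
  by split=> [x /Sa /R0 /t01 //|h]; apply: nt => x /h /Sa /R0.
Qed.

Lemma len_add Q R P n : submod Q -> submod R -> submod P ->
  Q `<=` R -> R `<=` P -> lenle Q P n -> len Q P = (len Q R + len R P)%N.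
Proof.
move=> hQ hR hP QR RP h; have QP := subset_trans QR RP.
have [c1 l1] := lenP hQ QR (lenle_sub (@subset_refl _ Q) RP h).
have [c2 l2] := lenP hR RP (lenle_sub QR (@subset_refl _ P) h).
have [c l] := lenP hQ QP h.
apply/eqP; rewrite eqn_leq; apply/andP; split; last exact: l _ (chain_add QR RP c1 c2).
exact: (lenle_add hR QR RP hP l1 l2 c).
Qed.

End Length.

Section LengthTransfer.
Variables (A : comNzRingType) (V W : lmodType A).

(** Lengths in different modules are compared only through this fact: a map that
    preserves and reflects inclusions sends strict chains to strict chains. *)
Lemma lenle_map (phi : set V -> set W) (Q P : set V) (Q' P' : set W) n :
  (forall S, between Q P S -> between Q' P' (phi S)) ->
  (forall S S', between Q P S -> between Q P S' -> S `<=` S' ->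
     phi S `<=` phi S') ->
  (forall S S', between Q P S -> between Q P S' -> S `<=` S' ->
     phi S' `<=` phi S -> S' `<=` S) ->
  lenle Q' P' n -> lenle Q P n.
Proof.
move=> hphi mono refl h k [S [h1 h2]]; apply: h; exists (phi \o S).
split=> i ik /=; first by apply/hphi/h1.
have [s ns] := h2 i ik; have b := h1 i (ltnW ik); have b' := h1 i.+1 ik.
by split=> [|h]; [exact: mono|exact: ns (refl _ _ b b' s h)].
Qed.

End LengthTransfer.

(** The correspondence theorem: [f] induces an isomorphism from
    [P / (P :&: f^-1 B)] onto [(f P + B) / B]. *)
Lemma lenle_corr (A : comNzRingType) (V W : lmodType A) (f : {linear V -> W})
    (P : set V) (B : set W) n : submod P -> submod B ->
  lenle [set v | P v /\ B (f v)] P n <-> lenle B (addS (f @` P) B) n.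
Proof.
move=> hP hB; have hfP := submod_image f hP; split.
- apply: (@lenle_map _ _ _ (fun U => [set v | P v /\ U (f v)]))
    => [U [hU BU UP]|U U' _ _ UU' v|].
  + split; last by move=> v [].
      exact: (submodI hP (submod_preimage f hU)).
    by move=> v [Pv /BU].
  + by move=> [Pv /UU'].
  + move=> U U' [hU BU UP] [hU' BU' UP'] UU' h w U'w.
    have [_ [b [[v Pv <-] Bb e]]] := UP' w U'w.
    rewrite e; apply: submodD => //; last exact: BU.
    apply: (proj2 (h v _)); split=> //.
    apply: (@submodBr _ _ U' (- b)) => //; first exact: BU' (submodN hB Bb).
    by rewrite opprK -e.
- apply: (@lenle_map _ _ _ (fun U => addS (f @` U) B)) => [U [hU BU UP]|U U' _ _ UU'|].
  + split; first by apply: submod_addS => //; exact: submod_image.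
      exact: addSr (submod_image f hU).
    by apply: addS_mono => //; exact: image_subset.
  + by apply: addS_mono => //; exact: image_subset.
  + move=> U U' [hU BU UP] [hU' BU' UP'] UU' h v U'v.
    have [_ [b [[u Uu <-] Bb e]]] : addS (f @` U) B (f v).
      by apply: h; apply: addSl => //; exists v.
    apply: (submodBr hU Uu); apply: BU; split; last first.
      by rewrite linearB e addrC addKr.
    by apply: submodB => //; [exact: UP'|exact: UP].
Qed.

Lemma len_eq (A : comNzRingType) (V W : lmodType A) (Q P : set V) (Q' P' : set W) :
  (forall n, lenle Q P n <-> lenle Q' P' n) ->
  submod Q -> Q `<=` P -> submod Q' -> Q' `<=` P' -> len Q P = len Q' P'.
Proof.
move=> h hQ QP hQ' QP'; have [[n hn]|no] := pselect (exists n, lenle Q' P' n).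
  have hn' := (h n).2 hn.
  apply/eqP; rewrite eqn_leq; apply/andP; split; apply: len_le => //.
    by apply/h; exact: lenleP hn.
  by apply/h; exact: lenleP hn'.
rewrite /len; case: xgetP => [k _ [_ /h hk]|_]; first by case: no; exists k.
by case: xgetP => [k _ [_ hk]|//]; case: no; exists k.
Qed.

Lemma len_corr (A : comNzRingType) (V W : lmodType A) (f : {linear V -> W})
    (P : set V) (B : set W) : submod P -> submod B ->
  len [set v | P v /\ B (f v)] P = len B (addS (f @` P) B).
Proof.
move=> hP hB; apply: len_eq => //; first by move=> n; exact: lenle_corr.
- exact: submodI hP (submod_preimage f hB).
- by move=> v [].
- exact: addSr (submod_image f hP).
Qed.

(** * Noetherian modules over a local ring *)

Section Span.
Variables (A : comNzRingType) (V : lmodType A).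

Fixpoint spanS (s : seq V) : set V :=
  if s is x :: s' then addS (range (fun a : A => a *: x)) (spanS s')
  else [set 0].

Lemma submod_line (x : V) : submod (range (fun a : A => a *: x)).
Proof.
split=> [|_ _ [a _ <-] [b _ <-]|b _ [a _ <-]].
- by exists 0; rewrite ?scale0r.
- by exists (a + b); rewrite ?scalerDl.
- by exists (b * a); rewrite ?scalerA.
Qed.

Lemma submod_spanS s : submod (spanS s).
Proof.
elim: s => [|x s IH] /=; first exact: submod_set0.
exact: submod_addS (submod_line x) IH.
Qed.

Lemma spanS_mem (s : seq V) x : x \in s -> spanS s x.
Proof.
elim: s => //= y s IH; rewrite inE => /predU1P[->|/IH].
  by apply: addSl; [exact: submod_spanS|exists 1; rewrite ?scale1r].
by apply: addSr; exact: submod_line.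
Qed.

Lemma spanS_sub (s : seq V) (S : set V) :
  submod S -> (forall x, x \in s -> S x) -> spanS s `<=` S.
Proof.
move=> hS; elim: s => [_ _ -> /=|x s IH h /=]; first exact: submod0.
apply: addS_sub => // [_ [a _ <-]|].
  by apply: submodZ => //; apply: h; exact: mem_head.
by apply: IH => y ys; apply: h; rewrite inE ys orbT.
Qed.

(** A submodule given as a set, as a boolean predicate that carries its proof, so
    that it can be fed to statements about bundled submodules. *)
Definition as_pred (S : set V) (hS : submod S) : V -> bool := fun x => `[< S x >].

Fact as_pred_closed (S : set V) (hS : submod S) : subsemimod_closed (as_pred hS).
Proof.
split; first split; rewrite /as_pred.
- by apply/asboolP; exact: submod0.
- by move=> x y /asboolP hx /asboolP hy; apply/asboolP; exact: submodD.
- by move=> a x /asboolP hx; apply/asboolP; exact: submodZ.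
Qed.

HB.instance Definition _ (S : set V) (hS : submod S) :=
  GRing.isSubmodClosed.Build A V (as_pred hS) (as_pred_closed hS).

Lemma as_predP (S : set V) (hS : submod S) x : (x \in as_pred hS) = `[< S x >].
Proof. by []. Qed.

Lemma submodClosedP (J : submodClosed V) : submod [set x | x \in J].
Proof.
split=> [|x y|a x] /=; [exact: rpred0|exact: rpredD|exact: rpredZ].
Qed.

Lemma submod_span_set (G : set V) : submod [set x | x \in submod_span G].
Proof. exact: submodClosedP. Qed.

Lemma submod_span_sub (G S : set V) : submod S -> G `<=` S ->
  [set x | x \in submod_span G] `<=` S.
Proof.
move=> hS GS x /asboolP /(_ (GRing.SubmodClosed.clone A _ (as_pred hS) _)).
by rewrite as_predP => h; apply/asboolP/h => y /GS Sy; rewrite as_predP; apply/asboolP.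
Qed.

Lemma submod_span_mem (G : set V) x : G x -> x \in submod_span G.
Proof. by move=> Gx; apply/asboolP => S; exact. Qed.

Lemma submod_spanE (s : seq V) x : x \in submod_span [set` s] <-> spanS s x.
Proof.
split; first by apply: submod_span_sub; [exact: submod_spanS|exact: spanS_mem].
by apply: (spanS_sub (@submod_span_set _)) => y; exact: submod_span_mem.
Qed.

End Span.

Definition noeth (A : comNzRingType) (V : lmodType A) : Prop :=
  forall S : set V, submod S -> exists s, S = spanS s.

Section Noetherian.
Variables (A : comNzRingType) (V : lmodType A).
Hypothesis hV : noeth V.

Lemma noeth_acc (S : nat -> set V) : (forall n, submod (S n)) ->
  (forall n, S n `<=` S n.+1) -> exists n0, forall n, S n `<=` S n0.
Proof.
move=> hS inc.
have mono i j : (i <= j)%N -> S i `<=` S j.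
  move=> /subnK <-; elim: (j - i)%N => [//|k IH] x /IH.
  by rewrite addSn; exact: inc.
have [|s es] := hV (S := [set x | exists n, S n x]).
  split; first by exists 0%N; exact: submod0.
    move=> x y [i Six] [j Sjy]; exists (maxn i j); apply: submodD => //.
      by apply: mono Six; exact: leq_maxl.
    by apply: mono Sjy; exact: leq_maxr.
  by move=> a x [i Six]; exists i; exact: submodZ.
have [n0 h] : exists n0, forall x, x \in s -> S n0 x.
  have : forall x, x \in s -> exists n, S n x.
    by move=> x xs; have : spanS s x := spanS_mem xs; rewrite -es.
  elim: s {es} => [|y s IH] h; first by exists 0%N.
  have [|n1 h1] := IH; first by move=> x xs; apply: h; rewrite inE xs orbT.
  have [n2 h2] := h y (mem_head _ _); exists (maxn n1 n2) => x.
  rewrite inE => /predU1P[->|/h1].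
    by apply: mono h2; exact: leq_maxr.
  by apply: mono; exact: leq_maxl.
exists n0 => n x Snx; apply: (spanS_sub (hS n0) h).
by rewrite -es; exists n.
Qed.

Lemma noeth_maximal (F : set (set V)) (S0 : set V) :
  F S0 -> (forall S, F S -> submod S) ->
  exists S, [/\ F S, S0 `<=` S & forall S', F S' -> S `<=` S' -> S' `<=` S].
Proof.
move=> FS0 hF; have [//|no] := pselect (exists S, [/\ F S, S0 `<=` S &
  forall S', F S' -> S `<=` S' -> S' `<=` S]).
have step S : exists S', F S -> S0 `<=` S ->
    [/\ F S', S `<=` S' & ~ (S' `<=` S)].
  have [[FS SS]|h] := pselect (F S /\ S0 `<=` S); last by exists S => FS SS; case: h.
  have [//|no'] := pselect (exists S', F S -> S0 `<=` S ->
    [/\ F S', S `<=` S' & ~ (S' `<=` S)]).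
  case: no; exists S; split=> // S' FS' SS'.
  have [//|n] := pselect (S' `<=` S).
  by case: no'; exists S'.
have [g gP] := choice step.
pose T n := iter n g S0.
have TP n : F (T n) /\ S0 `<=` T n.
  elim: n => [|n [Fn sn]]; first by split.
  have [? h _] := gP _ Fn sn.
  by split=> // x /sn /h.
have [n|n|n0 /(_ n0.+1)] := @noeth_acc T.
- by apply: hF; have [] := TP n.
- by have [Fn sn] := TP n; have [] := gP _ Fn sn.
- by have [Fn sn] := TP n0; have [] := gP _ Fn sn.
Qed.

End Noetherian.

Section ProductsOfScalars.
Variables (A : comNzRingType) (V : lmodType A).
Implicit Types (P R : set V) (s : seq A).

Definition scalS s P : set V :=
  foldr (fun c => addS (mulS c P)) [set 0] s.

Lemma submod_scalS s P : submod P -> submod (scalS s P).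
Proof.
move=> hP; elim: s => [|c s IH] /=; first exact: submod_set0.
by apply: submod_addS => //; exact: submod_mulS.
Qed.

Lemma scalS_mem s P c v : submod P -> c \in s -> P v -> scalS s P (c *: v).
Proof.
move=> hP; elim: s => //= d s IH; rewrite inE => /predU1P[->|cs] Pv.
  by apply: addSl; [exact: submod_scalS|exists v].
by apply: addSr; [exact: submod_mulS|exact: IH].
Qed.

Lemma scalS_sub s P S : submod S ->
  (forall c v, c \in s -> P v -> S (c *: v)) -> scalS s P `<=` S.
Proof.
move=> hS; elim: s => [_ _ ->|c s IH h] /=; first exact: submod0.
apply: addS_sub => // [_ [v Pv ->]|]; first by apply: h => //; exact: mem_head.
by apply: IH => d v ds; apply: h; rewrite inE ds orbT.
Qed.

Lemma scalS_span (s : seq A^o) P a v :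
  submod P -> spanS s a -> P v -> scalS s P ((a : A) *: v).
Proof.
move=> hP sa Pv; move: a sa; apply: spanS_sub; last by move=> c cs; exact: scalS_mem.
have hs := submod_scalS s hP; split=> [|x y|a x] /=.
- by rewrite scale0r; exact: submod0.
- by rewrite scalerDl; exact: submodD.
- by rewrite -scalerA; exact: submodZ.
Qed.

(** When [c ^+ e] kills [P / R], every step of the filtration of [P] by
    [R + c ^+ j P] is a quotient of [P / (R + c P)]. *)
Lemma lenle_nilpotent c e P R l : submod P -> submod R -> R `<=` P ->
  mulS (c ^+ e) P `<=` R -> lenle (addS R (mulS c P)) P l ->
  lenle R P (e * l).
Proof.
move=> hP hR RP ceR hl.
suff h j : lenle (addS R (mulS (c ^+ j) P)) P (j * l).
  by apply: lenle_sub (h e) => //; exact: addS_sub.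
elim: j => [|j IH].
  rewrite mul0n; apply: lenle0 => v Pv; exists 0, v.
  by rewrite add0r; split=> //; [exact: submod0|exists v; rewrite ?expr0 ?scale1r].
have hj k : submod (addS R (mulS (c ^+ k) P)).
  by apply: submod_addS => //; exact: submod_mulS.
rewrite mulSn; apply: (lenle_add (hj j) _ _ hP _ IH).
- apply: addS_mono => // _ [v Pv ->]; exists (c *: v); first exact: submodZ.
  by rewrite scalerA exprSr.
- by apply: addS_sub => //; exact: mulS_sub.
pose f : {linear V -> V} := (c ^+ j) \*: idfun.
have /(lenle_corr f l hP) h : submod (addS R (mulS (c ^+ j.+1) P)) by exact: hj.
apply: (@lenle_sub _ _ _ _ _ _ l _ _ (h.1 _)) => //.
  apply: addS_sub.
  - exact: submod_addS (submod_image _ hP) (hj _).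
  - move=> v Rv; apply: addSr; first exact: submod_image.
    by apply: addSl; first exact: submod_mulS.
  - by move=> _ [v Pv ->]; apply: addSl => //; exists v.
apply: lenle_sub hl => // _ [x [_ [Rx [v Pv ->] ->]]].
split; first by apply: submodD => //; [exact: RP|exact: submodZ].
rewrite /f /= scalerDr scalerA -exprSr; exists (c ^+ j *: x), (c ^+ j.+1 *: v).
by split=> //; [exact: submodZ|exists v].
Qed.

Lemma lenle_nilpotents s e P R l : submod P -> submod R -> R `<=` P ->
  (forall c, c \in s -> mulS (c ^+ e) P `<=` R) ->
  lenle (addS R (scalS s P)) P l -> lenle R P (e ^ size s * l).
Proof.
move=> hP; elim: s R => [|c s IH] R hR RP hs hl /=.
  rewrite expn0 mul1n; apply: lenle_sub hl => //.
  by apply: addS_sub => //= _ ->; exact: submod0.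
have hc := submod_mulS c hP.
rewrite expnS -mulnA; apply: (@lenle_nilpotent c) => //.
  by apply: hs; exact: mem_head.
have RcP : addS R (mulS c P) `<=` P by apply: addS_sub => //; exact: mulS_sub.
apply: IH => //; first exact: submod_addS.
  move=> d ds; apply: subset_trans (addSl hc).
  by apply: hs; rewrite inE ds orbT.
apply: lenle_sub hl => // _ [x [_ [Rx [y [z [cy sz ->]]] ->]]].
by exists (x + y), z; split=> //; [exists x, y|rewrite addrA].
Qed.

End ProductsOfScalars.

Section FinGen.
Variable A : comNzRingType.
Hypothesis hA : noeth A^o.

(** A submodule of [A x + span s] is recovered from its intersection with [span s]
    and the ideal of the coefficients of [x] in its elements. *)
Lemma noeth_span (V : lmodType A) (s : seq V) (S : set V) :
  submod S -> S `<=` spanS s -> exists t, S = spanS t.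
Proof.
elim: s S => [|x s IH] S hS Ss.
  by exists [::]; apply/seteqP; split=> //= _ ->; exact: submod0.
have hs := submod_spanS s.
have [t et] := IH _ (submodI hS hs) (@subIsetr _ _ _).
pose J : set A^o := [set a | exists2 v, S v & spanS s (v - (a : A) *: x)].
have [|r er] := hA (S := J).
  split=> [|a b [v Sv sv] [w Sw sw]|a b [v Sv sv]].
  - by exists 0; [|rewrite scale0r subr0]; exact: submod0.
  - exists (v + w); first exact: submodD.
    by rewrite scalerDl opprD addrACA; exact: submodD.
  - exists (a *: v); first exact: submodZ.
    by rewrite -scalerA -scalerBr; exact: submodZ.
have [u [uS uJ]] : exists u : seq V, (forall v, v \in u -> S v) /\
    forall a, spanS r a -> exists2 v, spanS u v & spanS s (v - (a : A) *: x).
  have : forall a, a \in r -> J a by move=> a ar; rewrite er; exact: spanS_mem.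
  elim: r {er} => [_|a r IHr hr].
    exists [::]; split=> // _ ->; exists 0 => //.
    by rewrite scale0r subr0; exact: submod0.
  have [|u [u1 u2]] := IHr; first by move=> b br; apply: hr; rewrite inE br orbT.
  have [v Sv sv] := hr a (mem_head _ _).
  exists (v :: u); split=> [w|_ [_ [b [[c _ <-] rb ->]]]].
    by rewrite inE => /predU1P[->|/u1].
  have [w uw sw] := u2 b rb.
  exists (c *: v + w); first by exists (c *: v), w; split=> //; exists c.
  rewrite scalerDl opprD addrACA; apply: submodD => //.
  by rewrite -scalerA -scalerBr; exact: submodZ.
exists (u ++ t); apply/seteqP; split; last first.
  apply: spanS_sub => // y; rewrite mem_cat => /orP[/uS //|yt].
  by have : spanS t y := spanS_mem yt; rewrite -et => -[].
have sub1 : spanS u `<=` spanS (u ++ t).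
  apply: (spanS_sub (submod_spanS _)) => y yu.
  by apply: spanS_mem; rewrite mem_cat yu.
have sub2 : spanS t `<=` spanS (u ++ t).
  apply: (spanS_sub (submod_spanS _)) => y yu.
  by apply: spanS_mem; rewrite mem_cat yu orbT.
move=> v Sv; have [_ [w [[a _ <-] sw e]]] := Ss v Sv.
have [|y uy sy] := uJ a.
  by rewrite -er; exists v => //; rewrite e addrC addKr.
apply: (submodBr (submod_spanS _) (sub1 _ uy)); apply: sub2.
rewrite -et; split.
  by apply: submodB => //; apply: (spanS_sub hS uS).
have -> : v - y = w - (y - a *: x) by rewrite e opprB addrA [w + _]addrC.
exact: submodB.
Qed.

Lemma noeth_fg (V : lmodType A) (s : seq V) : spanS s = setT -> noeth V.
Proof. by move=> e S hS; apply: (noeth_span (s := s)) => //; rewrite e. Qed.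

End FinGen.

Lemma noetherian_noeth (A : comNzRingType) : noetherian A -> noeth A^o.
Proof.
move=> hN S hS; have [s es] := hN (GRing.SubmodClosed.clone A _ (as_pred hS) _).
exists s; apply/seteqP; split=> x.
  by move=> Sx; apply/submod_spanE; rewrite -es as_predP; apply/asboolP.
by move/submod_spanE; rewrite -es as_predP => /asboolP.
Qed.

Lemma fin_gen_span (A : comNzRingType) (V : lmodType A) :
  fin_gen V -> exists s : seq V, spanS s = setT.
Proof.
by case=> s hs; exists s; apply/seteqP; split=> // x _; apply/submod_spanE; rewrite hs.
Qed.

Section Local.
Variables (A : comNzRingType) (m : submodClosed A^o).
Hypotheses (hA : noeth A^o) (hm : local_ring m).

(** A proper ideal lies in a maximal one, and [m] is the only one. *)
Lemma local_proper (J : set A^o) : submod J -> ~ J 1 -> J `<=` [set a | a \in m].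
Proof.
move=> hJ J1.
have [||U [[hU U1] JU maxU]] :=
  noeth_maximal hA (F := [set S | submod S /\ ~ S 1]) (S0 := J); first by split.
  by move=> S [].
pose u : submodClosed A^o := GRing.SubmodClosed.clone A _ (as_pred hU) _.
have uP x : (x \in u) = `[< U x >] by exact: as_predP.
have hu : maximal_ideal u.
  split=> [/(_ 1)|J' uJ']; first by rewrite uP => /asboolP.
  have hJ' := submodClosedP J'.
  have UJ' : U `<=` [set x | x \in J'].
    by move=> x Ux; apply: uJ'; rewrite uP; apply/asboolP.
  have [J1'|J1'] := pselect ((1 : A^o) \in J').
    by right=> x; rewrite inE -(mulr1 x); apply: (submodZ x hJ').
  left=> x; rewrite uP; apply/idP/asboolP => [xJ'|/UJ' //].
  exact: (maxU [set x | x \in J'] (conj hJ' J1') UJ').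
have [_ /(_ u hu) um] := hm.
by move=> x /JU Ux; rewrite /= -um uP; apply/asboolP.
Qed.

Lemma local_1_notin : ~~ ((1 : A^o) \in m).
Proof.
have [[nm _] _] := hm; apply/negP => m1; apply: nm => x.
by rewrite inE -(mulr1 x); apply: (submodZ (x : A) (submodClosedP m) m1).
Qed.

Lemma local_unit (c : A) : ~~ ((c : A^o) \in m) -> exists d, d * c = 1.
Proof.
move=> cm; have [[d _ dc]|nd] := pselect (range (fun a : A => a *: (c : A^o)) 1).
  by exists d.
case/negP: cm; apply: (local_proper (submod_line (c : A^o)) nd).
by exists 1; rewrite ?scale1r.
Qed.

Lemma local_1B (a : A^o) : a \in m -> exists d : A, d * (1 - a) = 1.
Proof.
move=> am; apply: local_unit; apply/negP => h.
have := submodD (submodClosedP m) h am; rewrite subrK => m1.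
by move/negP: local_1_notin.
Qed.

(** The hypothesis on [U] says [K `<=` B + m K]. A submodule [U] maximal among
    those that contain [B] but not [K] would have [K `<=` U + A v] for any [v]
    in [K] outside [U], whence [v] in [U + m v] and so [v] in [U]. *)
Lemma nakayama (V : lmodType A) (K B : set V) : noeth V -> submod K -> submod B ->
  (forall U, submod U -> B `<=` U ->
     (forall (a : A) v, (a : A^o) \in m -> K v -> U (a *: v)) -> K `<=` U) ->
  K `<=` B.
Proof.
move=> hV hK hB h; have [//|nKB] := pselect (K `<=` B).
have [||U [[hU BU KU] _ maxU]] := noeth_maximal hV
  (F := [set S | [/\ submod S, B `<=` S & ~ (K `<=` S)]]) (S0 := B) _ _; first by split.
  by move=> S [].
have [v [Kv Uv]] : exists v, K v /\ ~ U v.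
  by apply: contrapT => no; apply: KU => v Kv; apply: contrapT => Uv; apply: no; exists v.
have KUv : K `<=` addS (range (fun a : A => a *: v)) U.
  have [//|nK] := pselect (K `<=` addS (range (fun a : A => a *: v)) U).
  have hl := submod_line v; case: Uv.
  apply: (maxU (addS (range (fun a : A => a *: v)) U)).
  - by split=> //; [exact: submod_addS|move=> x /BU; exact: addSr].
  - exact: addSr.
  - by apply: addSl => //; exists 1; rewrite ?scale1r.
pose Uv' : set V := [set w | exists2 a : A^o, a \in m & U (w - (a : A) *: v)].
have : K `<=` Uv'.
  apply: h.
  - split.
    + by exists 0; [exact: rpred0|rewrite scale0r subr0; exact: submod0].
    + move=> x y [a am ax] [b bm by_]; exists (a + b); first exact: rpredD.
      by rewrite scalerDl opprD addrACA; exact: submodD.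
    + move=> c x [a am ax]; exists (c *: a); first exact: (submodZ c (submodClosedP m)).
      by rewrite -scalerA -scalerBr; exact: submodZ.
  - by move=> x Bx; exists 0; [exact: rpred0|rewrite scale0r subr0; exact: BU].
  - move=> a w am /KUv[_ [y [[b _ <-] Uy ->]]]; exists (b *: (a : A^o)).
      exact: (submodZ b (submodClosedP m)).
    have -> : a *: (b *: v + y) - (b * a) *: v = a *: y.
      by rewrite scalerDr scalerA mulrC addrC addKr.
    exact: submodZ.
move=> /(_ v Kv) [a am]; rewrite -{1}(scale1r v) -scalerBl => Uav.
have [d hd] := local_1B am; case: Uv.
by rewrite -(scale1r v) -hd -scalerA; exact: submodZ.
Qed.

(** [(L + A x) / L] is a quotient of the residue field. *)
Lemma lenle_line (V : lmodType A) (L P : set V) x : submod L ->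
  (forall a : A, (a : A^o) \in m -> L (a *: x)) ->
  P `<=` addS (range (fun a : A => a *: x)) L -> lenle L P 1.
Proof.
move=> hL mx PL [//|[//|k]] [S [h1 h2]]; exfalso.
have [s01 ns01] := h2 0%N isT; have [s12 ns12] := h2 1%N isT.
have [_ L0 _] := h1 0%N isT; have [hS1 L1 _] := h1 1%N isT.
have [_ _ S2P] := h1 2%N isT.
apply: ns12; suff Sx : S 1%N x.
  move=> y /S2P /PL; apply: (addS_sub hS1) L1 _ => _ [a _ <-].
  exact: submodZ.
have [v [Sv Lv]] : exists v, S 1%N v /\ ~ L v.
  apply: contrapT => no; apply: ns01 => v Sv; apply: L0.
  by apply: contrapT => Lv; apply: no; exists v.
have [_ _ S1P] := h1 1%N isT.
have [_ [l [[c _ <-] Ll e]]] := PL _ (S1P _ Sv).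
have [d dc] : exists d, d * c = 1.
  apply: local_unit; apply/negP => cm; apply: Lv; rewrite e.
  by apply: submodD => //; exact: mx.
have -> : x = d *: (v - l) by rewrite e addrK scalerA dc scale1r.
by apply: submodZ => //; apply: submodB => //; exact: L1.
Qed.

Lemma lenle_span (V : lmodType A) (L : set V) (s : seq V) : submod L ->
  (forall (a : A) x, (a : A^o) \in m -> x \in s -> L (a *: x)) ->
  lenle L (addS (spanS s) L) (size s).
Proof.
move=> hL; elim: s => [|x s IH] ms /=.
  by apply: lenle0 => _ [_ [z [-> Lz ->]]]; rewrite add0r.
have hs := submod_spanS s; have hx := submod_line x.
have hLs := submod_addS hs hL.
rewrite -addn1; apply: (lenle_add hLs).
- exact: addSr.
- by apply: addS_mono => //; exact: addSr.
- by apply: submod_addS => //; exact: submod_addS.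
- by apply: IH => a y am ys; apply: ms; rewrite // inE ys orbT.
- apply: (@lenle_line _ _ _ x) => //.
    by move=> a am; apply: addSr => //; apply: ms => //; exact: mem_head.
  move=> _ [_ [z [[y [w [ly sw ->]]] Lz ->]]].
  by exists y, (w + z); split=> //; [exists w, z|rewrite addrA].
Qed.

End Local.

(** * The Artin-Rees lemma *)

Lemma uniform_bound (P : nat -> nat -> Prop) k :
  (forall n j j', (j <= j')%N -> P n j -> P n j') ->
  (forall n, (n <= k)%N -> exists j, P n j) ->
  exists j, forall n, (n <= k)%N -> P n j.
Proof.
move=> mono; elim: k => [|k IH] h.
  by have [j hj] := h 0%N isT; exists j => -[].
have [|j hj] := IH; first by move=> n nk; apply: h; exact: leqW.
have [j' hj'] := h k.+1 (leqnn _); exists (maxn j j') => n.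
rewrite leq_eqVlt => /predU1P[->|nk].
  by apply: mono hj'; exact: leq_maxr.
by apply: mono (hj n nk); exact: leq_maxl.
Qed.

Section ArtinRees.
Variables (A : comNzRingType) (V : lmodType A).
Hypothesis hV : noeth V.
Variable F : set V.
Hypothesis hF : submod F.

Definition powS (s : seq A) (n : nat) : set V := iter n (scalS s) F.

Lemma submod_powS s n : submod (powS s n).
Proof. by elim: n => //= n IH; exact: submod_scalS. Qed.

(** With [Q n = (s)^n F], this is [Q N + a Q (N - 1) + ... + a^(j-1) Q (N-j+1)],
    the part of [(a, s)^N F] of degree less than [j] in [a]. *)
Fixpoint low (a : A) s j N : set V :=
  if j is j'.+1 then addS (low a s j' N) (mulS (a ^+ j') (powS s (N - j')))
  else [set 0].

Lemma submod_low a s j N : submod (low a s j N).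
Proof.
elim: j => [|j IH] /=; first exact: submod_set0.
by apply: submod_addS => //; apply: submod_mulS; exact: submod_powS.
Qed.

Lemma low_mulX a s j N v : low a s j N v -> low a s j.+1 N.+1 (a *: v).
Proof.
elim: j v => [v ->|j IH _ [v [_ [hv [q Qq ->] ->]]]].
  by rewrite scaler0; exact: submod0 (submod_low _ _ _ _).
rewrite scalerDr scalerA -exprS; exists (a *: v), (a ^+ j.+1 *: q); split=> //.
  exact: IH.
by exists q; rewrite ?subSS.
Qed.

Lemma low_mul a s c j N v : c \in s -> (j <= N.+1)%N -> low a s j N v ->
  low a s j N.+1 (c *: v).
Proof.
move=> cs; elim: j v => [v _ ->|j IH _ jN [v [_ [hv [q Qq ->] ->]]]].
  by rewrite scaler0; exact: submod0 (submod_low _ _ _ _).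
exists (c *: v), (a ^+ j *: (c *: q)); split.
- exact: IH (ltnW jN) hv.
- exists (c *: q) => //; rewrite subSn //=.
  by apply: scalS_mem => //; exact: submod_powS.
- by rewrite scalerDr !scalerA mulrC.
Qed.

Lemma powS_low a s N : powS (a :: s) N `<=` low a s N.+1 N.
Proof.
elim: N => [|N IH].
  by move=> v Fv; exists 0, v; rewrite add0r; split=> //; exists v; rewrite ?scale1r.
apply: scalS_sub; first exact: submod_low.
move=> c v; rewrite inE => /predU1P[->|cs] /IH lv; first exact: low_mulX.
apply: (@addSl _ _ (low a s N.+1 N.+1)); last exact: low_mul lv.
by apply: submod_mulS; exact: submod_powS.
Qed.

(** A strong form of the Artin-Rees lemma, which says that the Rees module of [F]
    is noetherian. The proof is that of Hilbert's basis theorem: by induction on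
    [s], applied to the families [L j] of leading coefficients, that is of those
    [q] such that [a ^+ j *: q] lies in [Z] up to terms of lower degree in [a]. *)
Lemma artin_rees s (Z : nat -> set V) : (forall n, submod (Z n)) ->
  (forall n, Z n `<=` powS s n) ->
  (forall c n v, c \in s -> Z n v -> Z n.+1 (c *: v)) ->
  exists n0, forall n, (n0 <= n)%N -> Z n.+1 `<=` scalS s (Z n).
Proof.
elim: s Z => [|a s IH] Z hZ ZF sZ; first by exists 0%N => n _; exact: ZF.
pose L j n := [set q |
  powS s n q /\ addS (Z (n + j)%N) (low a s j (n + j)) (a ^+ j *: q)].
have hZl j N : submod (addS (Z N) (low a s j N)).
  by apply: submod_addS => //; exact: submod_low.
have hL j n : submod (L j n).
  exact: submodI (submod_powS s n)
    (submod_preimage ((a ^+ j) \*: idfun : {linear V -> V}) (hZl j (n + j)%N)).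
have LX j n : L j n `<=` L j.+1 n.
  move=> q [Qq [z [l [Zz hl e]]]]; split=> //; exists (a *: z), (a *: l).
  rewrite exprS -scalerA e scalerDr addnS; split=> //.
    by apply: sZ => //; exact: mem_head.
  exact: low_mulX.
have LM j j' n : (j <= j')%N -> L j n `<=` L j' n.
  move=> /subnK <-; elim: (j' - j)%N => [//|k IHk] q /IHk.
  by rewrite addSn; exact: LX.
have Ls j c n q : c \in s -> L j n q -> L j n.+1 (c *: q).
  move=> cs [Qq [z [l [Zz hl e]]]]; split.
    by apply: scalS_mem => //; exact: submod_powS.
  exists (c *: z), (c *: l); rewrite scalerA mulrC -scalerA e scalerDr addSn.
  split=> //; first by apply: sZ => //; rewrite inE cs orbT.
  by apply: low_mul => //; lia.
pose Loo n := [set q | exists j, L j n q].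
have hLoo n : submod (Loo n).
  split.
  - by exists 0%N; exact: submod0.
  - move=> x y [i Lx] [j Ly]; exists (maxn i j); apply: submodD => //.
      by apply: LM Lx; exact: leq_maxl.
    by apply: LM Ly; exact: leq_maxr.
  - by move=> c x [i Lx]; exists i; exact: submodZ.
have [noo hoo] : exists n0, forall n, (n0 <= n)%N -> Loo n.+1 `<=` scalS s (Loo n).
  apply: IH => // [n q [j []] //|c n q cs [j Lq]].
  by exists j; exact: Ls.
(* By the ascending chain condition up to degree [noo], by generation beyond it. *)
have [j0 hj0] : exists j0, forall n, Loo n `<=` L j0 n.
  have [||j0 hj0] := @uniform_bound (fun n j => Loo n `<=` L j n) noo.
  - by move=> n j j' jj' h x /h; exact: LM.
  - move=> n _; have [|n'|j h] := noeth_acc hV (S := fun j => L j n) => //.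
    by exists j => x [j' /h].
  exists j0 => n; have [/hj0 //|/ltnW] := leqP n noo.
  move=> /subnK <-; elim: (n - noo)%N => [|k IHk]; first exact: hj0.
  apply: subset_trans (hoo _ (leq_addl _ _)) _.
  by apply: scalS_sub => // c v cs /IHk; exact: Ls.
have [||n1 hn1] := @uniform_bound
    (fun j n1 => forall n, (n1 <= n)%N -> L j n.+1 `<=` scalS s (L j n)) j0.
- by move=> j n n' nn' h k n'k; apply: h; exact: leq_trans n'k.
- by move=> j _; apply: IH => // [n q []|c n q] //; exact: Ls.
exists (n1 + j0)%N => N hN; set T := scalS (a :: s) (Z N).
have hT : submod T by exact: submod_scalS.
have TZ : T `<=` Z N.+1 by apply: scalS_sub => // c v; exact: sZ.
(* Lower the degree in [a] of an element of [Z N.+1] by subtracting elements of [T]. *)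
suff h j : (j <= N.+2)%N -> Z N.+1 `&` low a s j N.+1 `<=` T.
  by move=> z Zz; apply: (h N.+2) => //; split=> //; exact/powS_low/ZF.
elim: j => [|j IHj] jN z [Zz]; first by move=> ->; exact: submod0.
case=> l [_ [hl [q Qq ->] e]].
have hTl : submod (addS T (low a s j N.+1)).
  by apply: submod_addS => //; exact: submod_low.
have Lq : L j (N.+1 - j)%N q.
  split=> //; rewrite subnK //; exists z, (- l); split=> //.
    by apply: submodN => //; exact: submod_low.
  by rewrite e [l + _]addrC addrK.
suff [t [l' [Tt hl' e']]] : addS T (low a s j N.+1) (a ^+ j *: q).
  apply: (submodBr hT Tt); apply: IHj; first exact: ltnW.
  split; first by apply: submodB => //; exact: TZ.
  have -> : z - t = l + l' by rewrite e e' addrCA [t + _]addrC addrK.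
  by apply: submodD => //; exact: submod_low.
have [jj0|] := leqP j j0.
  have Lq' : scalS s (L j (N - j)%N) q.
    by apply: (hn1 j) => //; [lia|rewrite -subSn //; lia].
  have hpre := submod_preimage ((a ^+ j) \*: idfun : {linear V -> V}) hTl.
  apply: (scalS_sub hpre _ Lq') => c v cs [_ [z1 [l1 [Zz1 hl1 e1]]]].
  have jN' : (N - j + j)%N = N by lia.
  rewrite jN' in Zz1 hl1.
  exists (c *: z1), (c *: l1); split.
  - by apply: scalS_mem => //; rewrite inE cs orbT.
  - by apply: low_mul => //; lia.
  - by rewrite /= scalerA mulrC -scalerA e1 scalerDr.
case: j jN {IHj} hl Qq Lq e hTl => [//|i] jN hl Qq Lq e hTl ij0.
have [_ [z1 [l1 [Zz1 hl1 e1]]]] : L i (N - i)%N q.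
  by apply: (LM j0) => //; apply: hj0; exists i.+1; rewrite -subSS.
have iN : (N - i + i)%N = N by lia.
rewrite iN in Zz1 hl1.
exists (a *: z1), (a *: l1); split.
- by apply: scalS_mem => //; exact: mem_head.
- exact: low_mulX.
- by rewrite exprS -scalerA e1 scalerDr.
Qed.

End ArtinRees.

(** * Functions that agree with a polynomial for large arguments *)

Definition evpoly (f : nat -> rat) : Prop :=
  exists p : {poly rat}, exists n0 : nat, forall n, (n0 <= n)%N -> f n = p.[n%:R].

Lemma evpoly_eq (f g : nat -> rat) n0 :
  (forall n, (n0 <= n)%N -> f n = g n) -> evpoly g -> evpoly f.
Proof.
move=> fg [p [n1 hp]]; exists p, (maxn n0 n1) => n; rewrite geq_max => /andP[h0 h1].
by rewrite fg // hp.
Qed.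

Lemma evpoly_const c : evpoly (fun=> c).
Proof. by exists c%:P, 0%N => n _; rewrite hornerC. Qed.

Lemma evpolyD f g : evpoly f -> evpoly g -> evpoly (fun n => f n + g n).
Proof.
move=> [p [n0 hp]] [q [n1 hq]]; exists (p + q), (maxn n0 n1) => n.
by rewrite geq_max => /andP[h0 h1]; rewrite hornerD hp // hq.
Qed.

Lemma evpolyB f g : evpoly f -> evpoly g -> evpoly (fun n => f n - g n).
Proof.
move=> [p [n0 hp]] [q [n1 hq]]; exists (p - q), (maxn n0 n1) => n.
by rewrite geq_max => /andP[h0 h1]; rewrite hornerD hornerN hp // hq.
Qed.

Lemma evpoly_sum (I : Type) (r : seq I) (f : I -> nat -> rat) :
  (forall i, evpoly (f i)) -> evpoly (fun n => \sum_(i <- r) f i n).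
Proof.
move=> h; elim: r => [|i r IH].
  by apply: (@evpoly_eq _ (fun=> 0) 0%N) (evpoly_const 0) => n _; rewrite big_nil.
apply: (@evpoly_eq _ (fun n => f i n + \sum_(i <- r) f i n) 0%N).
  by move=> n _; rewrite big_cons.
exact: evpolyD.
Qed.

Lemma evpolyS f : evpoly f -> evpoly (fun n => f n.+1).
Proof.
move=> [p [n0 hp]]; exists (p \Po ('X + 1)), n0 => n hn.
by rewrite hp ?leqW // horner_comp !hornerE -natr1.
Qed.

(** Falling factorials form a basis adapted to differences: that of degree [k + 1]
    has difference [k + 1] times that of degree [k]. *)
Lemma poly_difference (p : {poly rat}) :
  exists q : {poly rat}, forall x, q.[x + 1] - q.[x] = p.[x].
Proof.
pose ff k : {poly rat} := \prod_(i < k) ('X - (i%:R)%:P).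
have ffE k x : (ff k).[x] = \prod_(i < k) (x - i%:R).
  by rewrite horner_prod; apply: eq_bigr => i _; rewrite !hornerE.
have dff k x : (ff k.+1).[x + 1] - (ff k.+1).[x] = k.+1%:R * (ff k).[x].
  rewrite !ffE big_ord_recl [X in _ - X]big_ord_recr /= -ffE subr0.
  rewrite (eq_bigr (fun i : 'I_k => x - i%:R)); last first.
    by move=> i _; rewrite /bump /= natrD; ring.
  by rewrite -ffE -natr1; ring.
elim: {p}(size p) {-2}p (leqnn (size p)) => [|k IH] p.
  rewrite leqn0 size_poly_eq0 => /eqP ->; exists 0 => x.
  by rewrite !horner0 subr0.
move=> hp; pose c := p`_k.
have ffm : (ff k)`_k = 1 /\ size (ff k) = k.+1.
  have := size_prod_XsubC (index_enum 'I_k) (fun i => i%:R : rat).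
  rewrite /index_enum -enumT size_enum_ord => sz; rewrite enumT -/(index_enum _) in sz.
  split=> //.
  have /monicP := monic_prod_XsubC (index_enum 'I_k) predT (fun i => i%:R : rat).
  by rewrite lead_coefE sz.
have [|q hq] := IH (p - c *: ff k).
  apply/leq_sizeP => j; rewrite leq_eqVlt => /predU1P[<-|kj].
    by rewrite coefB coefZ ffm.1 mulr1 subrr.
  rewrite coefB coefZ (nth_default _ (leq_trans hp kj)).
  by rewrite (nth_default _ (_ : size (ff k) <= j)%N) ?ffm.2 // mulr0 subrr.
exists (q + (c / k.+1%:R) *: ff k.+1) => x.
have := hq x; rewrite !hornerE => hqx; rewrite opprD addrACA hqx -mulrBr dff mulrA.
by rewrite divfK ?pnatr_eq0 // subrK.
Qed.

Lemma evpoly_of_difference f : evpoly (fun n => f n.+1 - f n) -> evpoly f.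
Proof.
move=> [p [n0 hp]]; have [q hq] := poly_difference p.
exists (q + (f n0 - q.[n0%:R])%:P), n0 => n /subnK <-.
rewrite hornerD hornerC; elim: (n - n0)%N => [|k IH]; first by rewrite add0n; ring.
have := hp (k + n0)%N (leq_addl _ _); rewrite -hq addSn -natr1 => h.
by rewrite -(subrK (f (k + n0)%N) (f _.+1)) h IH; ring.
Qed.

(** * Hilbert functions *)

Section HilbertFunction.
Variables (A : comNzRingType) (V : lmodType A).
Hypothesis hV : noeth V.
Variable F : set V.
Hypothesis hF : submod F.

(** Hilbert's theorem for the graded module [n |-> Z n / B n] over the Rees
    algebra of [s], by induction on a list [t] of scalars containing all those
    that do not act as zero: multiplication by [b] has kernel and cokernel on
    which [b] is zero, and their lengths give the difference of the Hilbert
    function. *)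
Lemma hilbert_function (s t : seq A) (Z B : nat -> set V) : {subset t <= s} ->
  (forall n, submod (Z n)) -> (forall n, submod (B n)) ->
  (forall n, B n `<=` Z n) -> (forall n, Z n `<=` powS F s n) ->
  (forall c n v, c \in s -> Z n v -> Z n.+1 (c *: v)) ->
  (forall c n v, c \in s -> B n v -> B n.+1 (c *: v)) ->
  (forall c, c \in s -> c \in t \/ forall n v, Z n v -> B n.+1 (c *: v)) ->
  (forall n, exists k, lenle (B n) (Z n) k) ->
  evpoly (fun n => (len (B n) (Z n))%:R).
Proof.
move=> + hZ hB BZ ZF sZ.
elim: t Z B hZ hB BZ ZF sZ => [|b t IH] Z B hZ hB BZ ZF sZ ts sB zero fin.
  have [n0 h] := artin_rees hV hF hZ ZF sZ.
  apply: (@evpoly_eq _ (fun=> 0) n0.+1) (evpoly_const 0) => -[//|n] hn.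
  rewrite len_eq0 //; apply: subset_trans (h n hn) _; apply: scalS_sub => // c v cs.
  by have [//|h0] := zero c cs; exact: h0.
have bs : b \in s by apply: ts; exact: mem_head.
have ts' : {subset t <= s} by move=> c ct; apply: ts; rewrite inE ct orbT.
pose f : {linear V -> V} := b \*: idfun.
pose K n := [set v | Z n v /\ B n.+1 (f v)].
have hK n : submod (K n) := submodI (hZ n) (submod_preimage f (hB n.+1)).
have BK n : B n `<=` K n by move=> v Bv; split; [exact: BZ|exact: sB].
have KZ n : K n `<=` Z n by move=> v [].
pose C n := if n is n'.+1 then addS (f @` Z n') (B n) else B n.
have hfZ n := submod_image f (hZ n).
have hC n : submod (C n) by case: n => //= n; exact: submod_addS.
have BC n : B n `<=` C n by case: n => //= n; exact: addSr.
have CZ n : C n `<=` Z n.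
  case: n => [|n] /=; first exact: BZ.
  by apply: addS_sub => // _ [v Zv <-]; exact: sZ.
have CS n v : Z n v -> C n.+1 (f v) by move=> Zv; apply: addSl => //; exists v.
have eK : evpoly (fun n => (len (B n) (K n))%:R).
  apply: IH => // [n v /KZ /ZF //|c n v cs [Zv Bv]|c cs|n].
  - split; first exact: sZ.
    have -> : f (c *: v) = c *: f v by rewrite linearZ.
    exact: sB.
  - have [|h] := zero c cs; last by right=> n v /KZ; exact: h.
    by rewrite inE => /predU1P[->|]; [right=> n v []|left].
  - by have [k hk] := fin n; exists k; exact: lenle_sub hk.
have eC : evpoly (fun n => (len (C n) (Z n))%:R).
  apply: IH => // [c [|n] v cs|c cs|n].
  - by move=> Bv; apply: (BC 1%N); exact: sB.
  - move=> [_ [y [[x Zx <-] By ->]]]; rewrite scalerDr; apply: submodD => //.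
      have -> : c *: f x = f (c *: x) by rewrite linearZ.
      by apply: CS; exact: sZ.
    by apply: (BC n.+2); exact: sB.
  - have [|h] := zero c cs; last by right=> n v /h; exact: (BC n.+1).
    by rewrite inE => /predU1P[->|]; [right=> n v; exact: CS|left].
  - by have [k hk] := fin n; exists k; exact: lenle_sub hk.
apply: evpoly_of_difference.
apply: (@evpoly_eq _
  (fun n => (len (C n.+1) (Z n.+1))%:R - (len (B n) (K n))%:R) 0%N); last first.
  exact: evpolyB (evpolyS eC) eK.
move=> n _; have [k hk] := fin n; have [k' hk'] := fin n.+1.
rewrite (len_add (hB n) (hK n) (hZ n) (BK n) (@KZ n) hk).
rewrite (len_add (hB n.+1) (hC n.+1) (hZ n.+1) (BC n.+1) (CZ n.+1) hk').
rewrite (len_corr f (hZ n) (hB n.+1)) !natrD.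
by ring.
Qed.

End HilbertFunction.

(** * Finite free modules and coordinates *)

Section Vectors.
Variables (A : comNzRingType) (N : lmodType A) (a : nat).

Definition single (i : 'I_a) (x : N) : {ffun 'I_a -> N} :=
  [ffun j => if j == i then x else 0].

Lemma sum_single (v : {ffun 'I_a -> N}) : \sum_i single i (v i) = v.
Proof.
apply/ffunP => j; rewrite sum_ffunE (bigD1 j) //= ffunE eqxx big1 ?addr0 // => i ij.
by rewrite ffunE eq_sym (negPf ij).
Qed.

Lemma single_is_linear i : linear (single i).
Proof.
move=> c x y; apply/ffunP => j; rewrite !ffunE; case: eqP => // _.
by rewrite scaler0 addr0.
Qed.

HB.instance Definition _ i :=
  GRing.isLinear.Build A N {ffun 'I_a -> N} _ (single i) (single_is_linear i).

Definition entry (i : 'I_a) (v : {ffun 'I_a -> N}) : N := v i.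

Lemma entry_is_linear i : linear (entry i).
Proof. by move=> c v w; rewrite /entry !ffunE. Qed.

HB.instance Definition _ i :=
  GRing.isLinear.Build A {ffun 'I_a -> N} N _ (entry i) (entry_is_linear i).

Lemma noeth_ffun : noeth A^o -> fin_gen N -> noeth {ffun 'I_a -> N}.
Proof.
move=> hA /fin_gen_span[s hs].
apply: (@noeth_fg _ hA _ [seq single i x | i <- enum 'I_a, x <- s]).
apply/seteqP; split=> // v _; rewrite -(sum_single v).
have hS := submod_spanS [seq single i x | i <- enum 'I_a, x <- s].
apply: submod_sum => // i _.
have : spanS s (v i) by rewrite hs.
apply: (spanS_sub (submod_preimage (single i) hS)) => x xs.
by apply: spanS_mem; apply/allpairsP; exists (i, x); rewrite mem_enum.
Qed.

End Vectors.

Section Combinations.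
Variables (A : comNzRingType) (P : lmodType A) (a : nat) (e : 'I_a -> P).

Definition comb (v : {ffun 'I_a -> A^o}) : P := \sum_i (v i : A) *: e i.

Lemma comb_is_linear : linear comb.
Proof.
move=> c u v; rewrite /comb scaler_sumr -big_split; apply: eq_bigr => i _ /=.
by rewrite !ffunE scalerDl scalerA.
Qed.

HB.instance Definition _ :=
  GRing.isLinear.Build A {ffun 'I_a -> A^o} P _ comb comb_is_linear.

Lemma comb_single i : comb (single i 1) = e i.
Proof.
rewrite /comb (bigD1 i) //= ffunE eqxx scale1r big1 ?addr0 // => j ji.
by rewrite ffunE (negPf ji) scale0r.
Qed.

End Combinations.

Lemma comb_drop (A : comNzRingType) (P : lmodType A) (a : nat)
    (e : 'I_a.+1 -> P) (v : {ffun 'I_a.+1 -> A^o}) i (d : A) :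
  (forall x, exists c, x = comb e c) -> comb e v = 0 -> d * v i = 1 ->
  forall x, exists c, x = comb (e \o fintype.lift i) c.
Proof.
move=> he v0 hd x; have [c ->] := he x.
have ei : e i = \sum_j (- (d * v (fintype.lift i j))) *: e (fintype.lift i j).
  rewrite -(scale1r (e i)) -hd -scalerA; move: v0.
  rewrite /comb (bigD1_ord i) //= => /eqP; rewrite addr_eq0 => /eqP ->.
  rewrite scalerN scaler_sumr -sumrN; apply: eq_bigr => j _.
  by rewrite scalerA scaleNr.
exists [ffun j => (c (fintype.lift i j) : A) - (c i : A) * (d * v (fintype.lift i j))].
rewrite /comb (bigD1_ord i) //= ei scaler_sumr addrC -big_split.
by apply: eq_bigr => j _ /=; rewrite ffunE scalerBl scalerA mulrN scaleNr.
Qed.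

(** Finite free modules with a basis as data: every length below is computed in the
    powers of a module that the tensor products become in coordinates. *)
Record based (A : comNzRingType) (P : lmodType A) := Based {
  rk : nat;
  bas : 'I_rk -> P;
  crd : 'I_rk -> {linear P -> A^o};
  crdE : forall x, \sum_i (crd i x : A) *: bas i = x;
  crd_bas : forall i j, crd i (bas j) = (i == j)%:R
}.

Arguments bas {A P} b i.
Arguments crd {A P} b i.
Arguments crdE {A P} b x.
Arguments crd_bas {A P} b i j.

Section Projective.
Variables (A : comNzRingType) (m : submodClosed A^o).
Hypotheses (hA : noeth A^o) (hm : local_ring m).

(** For a minimal number of generators, the coefficients of a relation lie in
    [m]; a section of [A^a -> P] thus writes each relation as a combination of
    relations with coefficients in [m], and Nakayama's lemma applies. *)
Lemma projective_based (P : lmodType A) :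
  fin_gen P -> projective P -> exists b : based P, True.
Proof.
move=> /fin_gen_span[s hs] hP.
pose gen n := `[< exists e : 'I_n -> P, forall x, exists c, x = comb e c >].
have ex : exists n, gen n.
  exists (size s); apply/asboolP; exists (fun i => s`_i) => x.
  have : spanS s x by rewrite hs.
  elim: s {hs} x => [|y s IH] x /=; first by move=> ->; exists 0; rewrite linear0.
  move=> [_ [z [[a _ <-] /IH[c ->] ->]]].
  exists [ffun i => if unlift ord0 i is Some j then c j else a].
  rewrite /comb big_ord_recl ffunE unlift_none /=; congr (_ + _).
  by apply: eq_bigr => i _; rewrite ffunE liftK.
case: (ex_minnP ex) => a /asboolP[e he] mina.
have [|h hh] := hP _ _ (comb e : {linear _ -> _}) (idfun : {linear P -> P}).
  by move=> x; have [c ->] := he x; exists c.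
have rel_m v i : comb e v = 0 -> v i \in m.
  move=> v0; apply/negPn/negP => vi; have [d hd] := local_unit hA hm vi.
  case: a e he mina {h hh} v i v0 {vi} hd => [|a] e he mina v i v0 hd.
    by case: i hd.
  suff /mina : gen a by rewrite ltnn.
  by apply/asboolP; exists (e \o fintype.lift i); exact: comb_drop hd.
have ker0 v : comb e v = 0 -> v = 0.
  pose K := [set v | comb e v = 0].
  have hK : submod K := submod_preimage (comb e) (submod_set0 P).
  have fg : fin_gen A^o.
    exists [:: 1] => x; apply/idP; apply/submod_spanE.
    exists x, 0; rewrite addr0; split=> //.
    by exists x => //; exact: mulr1.
  suff : K `<=` [set 0] by exact.
  apply: (nakayama hA hm (noeth_ffun hA fg) hK (submod_set0 _)).
  move=> U hU _ mU {}v v0.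
  have -> : v = v - h (comb e v) by rewrite v0 linear0 subr0.
  have -> : v - h (comb e v) = \sum_i (v i : A) *: (single i 1 - h (e i)).
    rewrite -{1}(sum_single v) /comb linear_sum -sumrB; apply: eq_bigr => i _ /=.
    rewrite linearZ /= scalerBr; congr (_ - _); apply/ffunP => j; rewrite !ffunE.
    by case: eqP => _; rewrite ?scaler0 //; exact/esym/mulr1.
  apply: submod_sum => // i _; apply: mU; first exact: rel_m.
  by rewrite /K /= linearB /= comb_single (hh (e i) : comb e (h (e i)) = e i) subrr.
have hb i j : (entry i \o h : {linear P -> A^o}) (e j) = (i == j)%:R.
  rewrite /= /entry; have -> : h (e j) = single j 1.
    apply/esym/eqP; rewrite -subr_eq0; apply/eqP/ker0.
    by rewrite linearB /= comb_single (hh (e j) : comb e (h (e j)) = e j) subrr.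
  by rewrite ffunE; case: eqP.
by exists (@Based A P a e (fun i => entry i \o h) hh hb).
Qed.

End Projective.

(** * Tensor products in coordinates *)

Section TensorLift.
Variables (A : comNzRingType) (P N W : lmodType A) (g : P -> N -> W).
Hypotheses (gl : forall n, linear (g^~ n)) (gr : forall x, linear (g x)).

Definition freeg_lift (z : {freeg (P * N) / A}) : W :=
  fglift (fun p : P * N => g p.1 p.2) z.

Lemma freeg_lift_is_linear : linear freeg_lift.
Proof.
pose fl : {additive {freeg (P * N) / A} -> W} := HB.pack freeg_lift
  (GRing.isZmodMorphism.Build _ _ freeg_lift
    (lift_is_additive (fun p : P * N => g p.1 p.2))).
move=> a z t; rewrite [LHS](raddfD fl); congr (_ + _).
rewrite -{1}(freeg_sumE z) -[in RHS](freeg_sumE z) scaler_sumr.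
rewrite [LHS](raddf_sum fl) [X in a *: X](raddf_sum fl) scaler_sumr.
apply: eq_bigr => p _ /=.
have -> : a *: << coeff p z *g p >> = << a * coeff p z *g p >> :> {freeg (P * N) / A}.
  by apply/eqP/freeg_eqP => x; rewrite coeffZ !coeffU mulrA.
by rewrite /freeg_lift !liftU scalerA.
Qed.

HB.instance Definition _ := GRing.isLinear.Build A {freeg (P * N) / A} W _
  freeg_lift freeg_lift_is_linear.

Lemma freeg_lift_rel z : z \in submod_span (@bilin_rel A P N) -> freeg_lift z = 0.
Proof.
apply: (submod_span_sub (submod_preimage freeg_lift (submod_set0 W))) => {}z.
have E x n : freeg_lift << (x, n) >> = g x n by rewrite /freeg_lift liftU scale1r.
pose gL n : {linear P -> W} :=
  HB.pack (g^~ n) (GRing.isLinear.Build A _ _ _ (g^~ n) (gl n)).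
pose gR x : {linear N -> W} :=
  HB.pack (g x) (GRing.isLinear.Build A _ _ _ (g x) (gr x)).
case=> -[x [y [n ->]]]; rewrite /preimage /= (linearB freeg_lift);
  apply/eqP; rewrite subr_eq0; apply/eqP;
  rewrite ?(linearD freeg_lift) ?(linearZ_LR freeg_lift) /= !E.
- exact: (linearD (gL n)).
- exact: (linearD (gR x)).
- exact: (linearZ_LR (gL n)).
- exact: (linearZ_LR (gR y)).
Qed.

Lemma tensor_lift :
  exists t : {linear tensor P N -> W}, forall x n, t (tens x n) = g x n.
Proof.
pose t (u : tensor P N) := freeg_lift (quo_repr u).
have tE z : t (quo_pi _ z) = freeg_lift z.
  apply/eqP; rewrite -subr_eq0 -linearB; apply/eqP/freeg_lift_rel/quo_piP.
  exact: quo_reprK.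
have tlin : linear t.
  move=> a u v; rewrite -(quo_reprK u) -(quo_reprK v).
  by rewrite -linearP !tE linearP.
pose tL : {linear tensor P N -> W} := HB.pack t (GRing.isLinear.Build A _ _ _ t tlin).
exists tL => x n /=.
by rewrite tE /freeg_lift liftU scale1r.
Qed.

End TensorLift.

Definition vec (A : comNzRingType) (P : lmodType A) (b : based P)
  (N : lmodType A) : Type := {ffun 'I_(rk b) -> N}.

HB.instance Definition _ A P b N := GRing.Lmodule.on (@vec A P b N).

Section Coordinates.
Variables (A : comNzRingType) (P : lmodType A) (b : based P) (N : lmodType A).

Lemma based_lift (U W : lmodType A) (g : {linear U -> W}) (f : {linear P -> W}) :
  (forall x, exists u, g u = f x) ->
  exists h : {linear P -> U}, forall x, g (h x) = f x.
Proof.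
move=> hf; have [u hu] := choice (fun i => hf (bas b i)).
pose c x : {ffun 'I_(rk b) -> A^o} := [ffun i => crd b i x].
have clin : linear c by move=> a x y; apply/ffunP => i; rewrite !ffunE linearP.
pose cL : {linear P -> {ffun 'I_(rk b) -> A^o}} :=
  HB.pack c (GRing.isLinear.Build A _ _ _ c clin).
exists (comb u \o cL) => x /=; rewrite /comb linear_sum -[in RHS](crdE b x) linear_sum.
by apply: eq_bigr => i _; rewrite !linearZ /= hu ffunE.
Qed.

Definition pure (x : P) (n : N) : vec b N := [ffun i => (crd b i x : A) *: n].

Lemma pure_linearl n : linear (pure^~ n).
Proof.
by move=> c x y; apply/ffunP => i; rewrite !ffunE linearP scalerDl scalerA.
Qed.

Lemma pure_linearr x : linear (pure x).
Proof.
by move=> c n n'; apply/ffunP => i; rewrite !ffunE scalerDr !scalerA mulrC.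
Qed.

Lemma pure_bas i n : pure (bas b i) n = single i n.
Proof.
apply/ffunP => j; rewrite !ffunE crd_bas; case: eqP => _.
  exact: scale1r.
exact: scale0r.
Qed.

Definition of_vec (v : vec b N) : tensor P N := \sum_i tens (bas b i) (v i).

Lemma to_vec_exists : exists t : {linear tensor P N -> vec b N},
  forall x n, t (tens x n) = pure x n.
Proof. exact: tensor_lift pure_linearl pure_linearr. Qed.

Definition to_vec : {linear tensor P N -> vec b N} := sval (cid to_vec_exists).

Lemma to_vecE x n : to_vec (tens x n) = pure x n.
Proof. exact: (svalP (cid to_vec_exists)). Qed.

Lemma of_vecK : cancel of_vec to_vec.
Proof.
move=> v; rewrite linear_sum -[RHS]sum_single; apply: eq_bigr => i _.
by rewrite to_vecE pure_bas.
Qed.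

Lemma to_vecK : cancel to_vec of_vec.
Proof.
apply: tensor_ind => [|u v hu hv|a x n].
- rewrite linear0 /of_vec big1 // => i _.
  by rewrite ffunE -(scale0r 0) tensZr scale0r.
- rewrite linearD -{2}hu -{2}hv -big_split; apply: eq_bigr => i _ /=.
  by rewrite ffunE tensDr.
- rewrite linearZ /= to_vecE /of_vec -{2}(crdE b x).
  have -> : tens (\sum_i (crd b i x : A) *: bas b i) n =
            \sum_i (crd b i x : A) *: tens (bas b i) n.
    elim/big_rec2: _ => [|i y z _ <-]; first by rewrite -(scale0r 0) tensZl scale0r.
    by rewrite tensDl tensZl.
  rewrite scaler_sumr; apply: eq_bigr => i _; rewrite !ffunE.
  by rewrite !tensZr.
Qed.

End Coordinates.

Section MatrixAction.
Variables (A : comNzRingType) (P Q : lmodType A) (bP : based P) (bQ : based Q).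
Variables (N : lmodType A).

(** The map that [K (x) id_N] becomes in coordinates. *)
Definition mact (K : P -> Q) (v : vec bP N) : vec bQ N :=
  [ffun j => \sum_i (crd bQ j (K (bas bP i)) : A) *: v i].

Lemma mact_is_linear K : linear (mact K).
Proof.
move=> c v w; apply/ffunP => j; rewrite !ffunE scaler_sumr -big_split.
by apply: eq_bigr => i _ /=; rewrite !ffunE scalerDr !scalerA mulrC.
Qed.

HB.instance Definition _ K :=
  GRing.isLinear.Build A (vec bP N) (vec bQ N) _ (mact K) (mact_is_linear K).

Lemma mact_ext K K' v : K =1 K' -> mact K v = mact K' v.
Proof.
by move=> h; apply/ffunP => j; rewrite !ffunE; apply: eq_bigr => i _; rewrite h.
Qed.

Lemma mactD K K' v : mact (fun x => K x + K' x) v = mact K v + mact K' v.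
Proof.
apply/ffunP => j; rewrite !ffunE -big_split; apply: eq_bigr => i _ /=.
by rewrite linearD scalerDl.
Qed.

Lemma mact0 K v : (forall x, K x = 0) -> mact K v = 0.
Proof.
move=> h; apply/ffunP => j; rewrite !ffunE big1 // => i _.
by rewrite h linear0 scale0r.
Qed.

Lemma mact_pure (K : {linear P -> Q}) x n : mact K (pure bP x n) = pure bQ (K x) n.
Proof.
apply/ffunP => j; rewrite !ffunE -{2}(crdE bP x) !linear_sum scaler_suml.
by apply: eq_bigr => i _; rewrite !linearZ ffunE scalerA mulrC.
Qed.

Lemma to_vec_map (K : {linear P -> Q}) (u : tensor P N) :
  to_vec bQ N (tensor_map K u) = mact K (to_vec bP N u).
Proof.
elim/tensor_ind: u => [|u v hu hv|a x n].
- by rewrite !linear0.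
- by rewrite !linearD hu hv.
- by rewrite !linearZ /= tensor_mapE !to_vecE mact_pure.
Qed.

End MatrixAction.

Lemma mact_scale (A : comNzRingType) (P : lmodType A) (b : based P)
    (N : lmodType A) (c : A) (v : vec b N) :
  mact b ( *:%R c) v = c *: v.
Proof.
apply/ffunP => j; rewrite !ffunE (bigD1 j) //= linearZ crd_bas eqxx big1.
  by rewrite addr0 /= [_ *: 1]mulr1.
move=> i ij; rewrite linearZ crd_bas eq_sym (negPf ij) /= scaler0 scale0r //.
Qed.

Lemma mact_comp (A : comNzRingType) (P Q R : lmodType A) (bP : based P)
    (bQ : based Q) (bR : based R) (N : lmodType A) (K : P -> Q)
    (L : {linear Q -> R}) (v : vec bP N) :
  mact bR (fun x => L (K x)) v = mact bR L (mact bQ K v).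
Proof.
apply/ffunP => k; rewrite !ffunE.
under [RHS]eq_bigr do rewrite ffunE scaler_sumr.
rewrite exchange_big; apply: eq_bigr => i _ /=.
rewrite -{1}(crdE bQ (K (bas bP i))) !linear_sum scaler_suml; apply: eq_bigr => j _.
by rewrite (linearZ_LR L) (linearZ_LR (crd bR k)) scalerA mulrC.
Qed.

Section Entrywise.
Variables (A : comNzRingType) (P : lmodType A) (b : based P).
Variables (N N' : lmodType A) (g : {linear N -> N'}).

Definition vmap (v : vec b N) : vec b N' := [ffun i => g (v i)].

Lemma vmap_is_linear : linear vmap.
Proof. by move=> c v w; apply/ffunP => i; rewrite !ffunE linearP. Qed.

HB.instance Definition _ :=
  GRing.isLinear.Build A (vec b N) (vec b N') _ vmap vmap_is_linear.

End Entrywise.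

Lemma mact_vmap (A : comNzRingType) (P Q : lmodType A) (bP : based P)
    (bQ : based Q) (N N' : lmodType A) (g : {linear N -> N'}) K (v : vec bP N) :
  mact bQ K (vmap g v) = vmap g (mact bQ K v).
Proof.
apply/ffunP => j; rewrite !ffunE linear_sum; apply: eq_bigr => i _.
by rewrite linearZ ffunE.
Qed.

(** * Lengths of cohomology modules in coordinates *)

Lemma is_lengthE (A : comNzRingType) (T : lmodType A) n :
  is_length T n <-> chain [set 0] [set: T] n /\ lenle [set 0] [set: T] n.
Proof.
have h k : strict_chain T k <-> chain [set 0] [set: T] k.
  split=> [[S hS]|[S [h1 h2]]].
    exists (fun i => [set x | x \in S i]); split=> i ik.
      split=> // [|_ ->]; first exact: submodClosedP.
      exact: rpred0.
    have [sub neq] := hS i ik; split=> // sub'; apply: neq => x.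
    by apply/idP/idP; [exact: sub|exact: sub'].
  have [S' hS'] : exists S' : nat -> submodClosed T,
      forall i, (i <= k)%N -> forall x, (x \in S' i) = `[< S i x >].
    have h0 i : exists S' : submodClosed T,
        (i <= k)%N -> forall x, (x \in S') = `[< S i x >].
      case: (leqP i k) => [ik|_]; last first.
        by exists (GRing.SubmodClosed.clone A _ (as_pred (submodT T)) _).
      have [hSi _ _] := h1 i ik.
      by exists (GRing.SubmodClosed.clone A _ (as_pred hSi) _).
    by have [f hf] := choice h0; exists f.
  exists S' => i ik; have [sub nsub] := h2 i ik.
  have e := hS' i (ltnW ik); have e' := hS' i.+1 ik; split=> [x|eqS].
    by rewrite e e' => /asboolP/sub ?; apply/asboolP.
  by apply: nsub => x Sx; apply/asboolP; rewrite -e eqS e'; apply/asboolP.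
split=> -[c l]; (split; first exact/h); by move=> k /h; exact: l.
Qed.

Lemma mod_lengthE (A : comNzRingType) (T : lmodType A) :
  mod_length T = len [set 0] [set: T].
Proof.
rewrite /mod_length /len; congr (xget _ _).
by apply/seteqP; split=> n /= /is_lengthE.
Qed.

Lemma finite_lengthE (A : comNzRingType) (T : lmodType A) :
  finite_length T -> exists n, lenle [set 0] [set: T] n.
Proof. by case=> n /is_lengthE[_ h]; exists n. Qed.

Definition kerd (A : comNzRingType) (X : complex A) (i j : int) : set (X i) :=
  [set x | cdiff X i j x = 0].

Definition imd (A : comNzRingType) (X : complex A) (i j : int) : set (X j) :=
  range (cdiff X i j).

Arguments kerd {A} X i j x.
Arguments imd {A} X i j x.

Section CohomologyLength.
Variables (A : comNzRingType) (X : complex A).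

Lemma submod_kerd i j : submod (kerd X i j).
Proof. exact (submod_preimage (cdiff X i j) (submod_set0 _)). Qed.

Lemma submod_imd i j : submod (imd X i j).
Proof. exact: submod_image (submodT _). Qed.

Lemma imd_kerd i j k : imd X i j `<=` kerd X j k.
Proof. by move=> _ [x _ <-]; exact: cdiffK. Qed.

Lemma cohomology_lenle i n : lenle [set 0] [set: cohomology X i] n <->
  lenle (imd X (i - 1) i) (kerd X i (i + 1)) n.
Proof.
pose q : {linear cocycles X i -> cohomology X i} := quo_pi (@coboundaries A X i).
pose v : {linear cocycles X i -> X i} := (\val : kermod (cdiff X i (i + 1)) -> X i).
have hB : submod (@coboundaries A X i).
  split=> [|x y [u hu] [w hw]|a x [u hu]].
  - by rewrite /coboundaries /=; exists 0; rewrite !linear0.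
  - by rewrite /coboundaries /=; exists (u + w); rewrite !linearD /= hu hw.
  - by rewrite /coboundaries /=; exists (a *: u); rewrite !linearZ /= hu.
have qB : [set x | setT x /\ [set 0] (q x)] = @coboundaries A X i.
  apply/seteqP; split=> x.
    case=> _ /= qx0; apply: (submod_span_sub hB (@subset_refl _ _)).
    by rewrite /= -(subr0 x); apply/quo_piP; rewrite linear0.
  move=> hx; split=> //=; rewrite -(linear0 q); apply/quo_piP; rewrite subr0.
  exact: submod_span_mem.
have qT : addS (q @` setT) [set 0] = [set: cohomology X i].
  apply/seteqP; split=> // u _; exists u, 0; rewrite addr0; split=> //.
  by exists (quo_repr u) => //; exact: quo_reprK.
rewrite -qT -(lenle_corr q n (submodT _) (submod_set0 _)) qB.
have vB : [set x | setT x /\ imd X (i - 1) i (v x)] = @coboundaries A X i.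
  apply/seteqP; split=> x; first by case=> _ [y _ e]; exists y.
  by case=> y e; split=> //; exists y.
have vT : addS (v @` setT) (imd X (i - 1) i) = kerd X i (i + 1).
  apply/seteqP; split.
    apply: addS_sub (submod_kerd _ _) _ (@imd_kerd _ _ _) => _ [x _ <-].
    exact/eqP/(valP x).
  move=> x hx; exists x, 0; rewrite addr0; split=> //; last first.
    exact: submod0 (submod_imd _ _).
  have hx' : ker_pred (cdiff X i (i + 1)) x by apply/eqP.
  by exists (Sub x hx').
by rewrite -vT -(lenle_corr v n (submodT _) (submod_imd _ _)) vB.
Qed.

End CohomologyLength.

Definition vin (A : comNzRingType) (P : lmodType A) (b : based P)
    (W : lmodType A) (S : set W) : set (vec b W) := [set v | forall k, S (v k)].

Arguments vin {A P} b {W} S v.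

Lemma submod_vin (A : comNzRingType) (P : lmodType A) (b : based P)
  (W : lmodType A) (S : set W) : submod S -> submod (vin b S).
Proof.
move=> hS; split=> [k|v w hv hw k|a v hv k]; rewrite ffunE; first exact: submod0.
- exact: submodD.
- exact: submodZ.
Qed.

Lemma mact_vin (A : comNzRingType) (P Q : lmodType A) (bP : based P)
    (bQ : based Q) (W : lmodType A) (K : P -> Q) (S : set W) v :
  submod S -> vin bP S v -> vin bQ S (mact bQ K v).
Proof.
by move=> hS hv j; rewrite ffunE; apply: submod_sum => // i _; exact: submodZ.
Qed.

Definition dm (A : comNzRingType) (X : complex A) (b : forall i, based (X i))
    (W : lmodType A) i j : vec (b i) W -> vec (b j) W :=
  mact (b j) (cdiff X i j).

Arguments dm {A X} b {W} i j v.

HB.instance Definition _ A X b W i j :=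
  GRing.Linear.copy (@dm A X b W i j) (mact (b j) (cdiff X i j)).

(** For submodules [R] of [P], these are the cocycles and the coboundaries of the
    complex [X (x) P/R], seen in [X (x) P]. *)
Definition cyc (A : comNzRingType) (X : complex A) (b : forall i, based (X i))
    (W : lmodType A) (R P : set W) p q : set (vec (b p) W) :=
  [set v | vin (b p) P v /\ vin (b q) R (dm b p q v)].

Definition bnd (A : comNzRingType) (X : complex A) (b : forall i, based (X i))
    (W : lmodType A) (R P : set W) o p : set (vec (b p) W) :=
  addS (dm b o p @` vin (b o) P) (vin (b p) R).

Arguments cyc {A X} b {W} R P p q v.
Arguments bnd {A X} b {W} R P o p v.

Section ComplexInCoordinates.
Variables (A : comNzRingType) (X : complex A) (b : forall i, based (X i)).

Section Coefficients.
Variable W : lmodType A.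

Lemma dmK i j k (v : vec (b i) W) : dm b j k (dm b i j v) = 0.
Proof. by rewrite /dm -mact_comp mact0 // => x; rewrite cdiffK. Qed.

Lemma submod_cyc (R P : set W) p q : submod R -> submod P -> submod (cyc b R P p q).
Proof.
move=> hR hP; apply: submodI; first exact: submod_vin.
exact: (submod_preimage (dm b p q) (submod_vin (b q) hR)).
Qed.

Lemma submod_bnd (R P : set W) o p : submod R -> submod P -> submod (bnd b R P o p).
Proof.
move=> hR hP; apply: submod_addS; last exact: submod_vin.
exact: (submod_image (dm b o p) (submod_vin (b o) hP)).
Qed.

Lemma bnd_cyc (R P : set W) o p q : submod R -> submod P -> R `<=` P ->
  bnd b R P o p `<=` cyc b R P p q.
Proof.
move=> hR hP RP; apply: addS_sub; first exact: submod_cyc.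
  move=> _ [v hv <-]; split; first exact: mact_vin.
  by rewrite dmK; exact: submod0 (submod_vin _ hR).
by move=> v hv; split; [move=> k; exact: RP|exact: mact_vin].
Qed.

End Coefficients.

(** Two applications of the correspondence theorem: coordinates carry
    [X (x) M/J] to powers of [M/J], and these are quotients of powers of [M]. *)
Lemma tensor_cohomology_lenle (M : lmodType A) (G : set M) i n :
  let J := [set x | x \in submod_span G] in
  lenle [set 0] [set: cohomology (tensor_complex X (quomod G)) i] n <->
  lenle (bnd b J setT (i - 1) i) (cyc b J setT i (i + 1)) n.
Proof.
move=> J; have hJ : submod J := submod_span_set G.
rewrite cohomology_lenle.
pose N := quomod G; pose T := tensor_complex X N.
pose Z : set (vec (b i) N) := [set v | dm b i (i + 1) v = 0].
pose D : set (vec (b i) N) := range (@dm _ _ b N (i - 1) i).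
have hD : submod D := submod_image (@dm _ _ b N (i - 1) i) (submodT _).
have hZ : submod Z := submod_preimage (@dm _ _ b N i (i + 1)) (submod_set0 _).
have DZ : D `<=` Z by move=> _ [v _ <-]; exact: dmK.
pose f : {linear T i -> vec (b i) N} := to_vec (b i) N.
have fB : [set u | kerd T i (i + 1) u /\ D (f u)] = imd T (i - 1) i.
  apply/seteqP; split=> u.
    case=> _ [w _ e]; exists (of_vec w) => //.
    apply: (can_inj (to_vecK (b i) (N := N))); rewrite -[RHS]e -{2}(of_vecK w).
    exact: to_vec_map.
  move=> [w _ <-]; split; first exact: cdiffK.
  by exists (to_vec (b (i - 1)) N w) => //; exact/esym/to_vec_map.
have fT : addS (f @` kerd T i (i + 1)) D = Z.
  apply/seteqP; split.
    apply: addS_sub => // _ [u hu <-]; rewrite /Z /= /dm -to_vec_map.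
    by rewrite [X in to_vec _ _ X]hu linear0.
  move=> v hv; exists v, 0; rewrite addr0; split=> //; last exact: submod0.
  exists (of_vec v); last exact: of_vecK.
  apply: (can_inj (to_vecK (b (i + 1)) (N := N))); rewrite linear0 -hv -{2}(of_vecK v).
  exact: to_vec_map.
rewrite -{1}fB (lenle_corr f n (@submod_kerd _ T i (i + 1)) hD) fT.
pose q : {linear M -> N} := quo_pi G.
have qJ x : q x = 0 <-> J x.
  by rewrite -(linear0 q); split=> [/quo_piP|h]; [|apply/quo_piP]; rewrite subr0.
pose g : {linear vec (b i) M -> vec (b i) N} := vmap q.
have vq k (v : vec (b k) M) : vmap q v = 0 <-> vin (b k) J v.
  split=> [/ffunP h j|h]; first by apply/qJ; have := h j; rewrite !ffunE.
  by apply/ffunP => j; rewrite !ffunE; exact/qJ.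
have qsur k (w : vec (b k) N) : exists v : vec (b k) M, vmap q v = w.
  exists [ffun j => quo_repr (w j)]; apply/ffunP => j; rewrite !ffunE.
  exact: quo_reprK.
have gP : addS (g @` cyc b J setT i (i + 1)) D = Z.
  apply/seteqP; split.
    apply: addS_sub => // _ [v [_ hv] <-]; rewrite /Z /= /dm mact_vmap.
    exact/vq.
  move=> w hw; have [v e] := qsur i w; exists w, 0; rewrite addr0; split=> //.
    by exists v => //; split=> //; apply/vq; rewrite /dm -mact_vmap e.
  exact: submod0.
have hC : submod (cyc b J setT i (i + 1)) by exact: submod_cyc.
have gB : [set v | cyc b J setT i (i + 1) v /\ D (g v)] = bnd b J setT (i - 1) i.
  apply/seteqP; split=> v.
    case=> _ [w _ e]; have [u eu] := qsur _ w.
    exists (dm b (i - 1) i u), (v - dm b (i - 1) i u); split; first by exists u.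
      apply/vq; rewrite linearB; apply/eqP; rewrite subr_eq0; apply/eqP.
      by rewrite -[LHS]e -eu; exact: mact_vmap.
    by rewrite addrC subrK.
  move=> hv.
  have hc := @bnd_cyc M J setT (i - 1) i (i + 1) hJ (submodT _) (@subsetT _ J) v hv.
  split; first exact: hc.
  have [_ [y [[u _ <-] hy ->]]] := hv.
  exists (vmap q u) => //; rewrite linearD (_ : g y = 0) ?addr0; last exact/vq.
  exact: mact_vmap.
by rewrite -gP -(lenle_corr g n hC hD) gB.
Qed.

End ComplexInCoordinates.

(** * Contracting homotopies *)

(** Homotopies are families of maps indexed by pairs of degrees; this changes one
    member without transport along equalities of degrees elsewhere. *)
Lemma dep_update (T : int -> Type) (h : forall i, T i) t (u : T t) :
  exists h' : forall i, T i, h' t = u /\ forall i, i != t -> h' i = h i.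
Proof.
exists (fun i => if t =P i is ReflectT e then ecast i (T i) e u else h i).
split=> [|i it]; first by case: eqP => // e; rewrite (eq_axiomK e).
by case: eqP => // e; rewrite e eqxx in it.
Qed.

Section Homotopies.
Variables (A : comNzRingType) (X : complex A).

Definition kills (c : A) (i : int) : Prop :=
  forall z, kerd X i (i + 1) z -> imd X (i - 1) i (c *: z).

Definition homotopy_at (h : forall i j, {linear X i -> X j}) (c : A) (i : int) : Prop :=
  forall x, c *: x = cdiff X (i - 1) i (h i (i - 1) x)
                     + h (i + 1) i (cdiff X i (i + 1) x).

Hypothesis b : forall i, based (X i).
Variable B : int.
Hypothesis bounded_above : forall i, B < i -> forall x : X i, x = 0.

(** Downward induction on the degree: if [C = d h + h d] above degree [t], then
    [C - h d] maps [X t] into the cocycles, so [c (C - h d)] maps it into the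
    coboundaries and lifts through [d] because [X t] is free. *)
Lemma homotopy_above (c : A) (k : nat) :
  (forall i, B - k%:Z < i -> kills c i) ->
  exists h, forall i, B - k%:Z < i -> homotopy_at h (c ^+ k) i.
Proof.
elim: k => [_|k IH hc].
  exists (fun i j => \0 : {linear X i -> X j}) => i iB x.
  rewrite subr0 in iB.
  by rewrite (bounded_above iB x) scaler0 !linear0 addr0.
have [|h hh] := IH; first by move=> i ik; apply: hc; lia.
set t := B - k%:Z; have tk : B - k.+1%:Z < t by rewrite /t; lia.
have [hh' H] : exists h' : {linear X t -> X (t - 1)}, forall x,
    cdiff X (t - 1) t (h' x) =
    c *: (c ^+ k *: x - h (t + 1) t (cdiff X t (t + 1) x)).
  pose e : {linear X t -> X t} :=
    c \*: ((c ^+ k \*: idfun) \- (h (t + 1) t \o cdiff X t (t + 1))).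
  have [|h' hh'] := based_lift (b t) (g := cdiff X (t - 1) t) (f := e); last by exists h'.
  move=> x.
  have [|y _ hy] := hc t tk (c ^+ k *: x - h (t + 1) t (cdiff X t (t + 1) x)).
    2: by exists y.
  rewrite /kerd /= linearB linearZ /=.
  have := hh (t + 1) _ (cdiff X t (t + 1) x); rewrite addrK cdiffK linear0 addr0 => -> //.
    by rewrite subrr.
  by rewrite -/t; lia.
have [ht [htE _]] := dep_update (fun j => \0 : {linear X t -> X j}) hh'.
have [h2 [h2t h2E]] := dep_update (fun i j => c \*: h i j : {linear X i -> X j}) ht.
exists h2 => i ik x; have [e|it] := eqVneq i t.
  subst i; rewrite h2t htE H h2E; last by lia.
  by rewrite /= exprS -scalerA -scalerDr subrK.
rewrite !h2E //; last by lia.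
rewrite /= linearZ -scalerDr -hh ?scalerA ?exprS // -/t.
by move: ik it; rewrite /t; lia.
Qed.

End Homotopies.

Section BoundedHomotopies.
Variables (A : comNzRingType) (X : complex A).
Hypothesis b : forall i, based (X i).
Hypothesis bX : bounded X.

Lemma bounded_above : exists B : nat, (forall i, B%:Z < i -> forall x : X i, x = 0) /\
  forall i, i < - B%:Z -> forall x : X i, x = 0.
Proof.
have [B hB] := bX; exists `|B|%N; split=> i iB; apply: hB; lia.
Qed.

Lemma null_homotopy (c : A) : (forall i, kills X c i) ->
  exists k (h : forall i j, {linear X i -> X j}), forall i, homotopy_at h (c ^+ k) i.
Proof.
move=> hc; have [B [hB hB']] := bounded_above.
(* There are [2 B + 1] degrees between [- B] and [B]. *)
have [|h hh] := @homotopy_above A X b B hB c (B + B).+1; first by [].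
exists (B + B).+1, h => i; have [ik|ik] := ltrP (B%:Z - (B + B).+1%:Z) i; first exact: hh.
move=> x; have -> : x = 0 by apply: hB'; lia.
by rewrite scaler0 !linear0 addr0.
Qed.

Lemma contractible_iso :
  (exists h : forall i j, {linear X i -> X j}, forall i, homotopy_at h 1 i) ->
  homotopy_iso X (zero_complex A).
Proof.
case=> h hh.
pose f : chain_map X (zero_complex A) :=
  @ChainMap A X (zero_complex A) (fun i => \0) (fun i j x => erefl).
have g0 i j (x : zero_complex A i) :
    \0 (cdiff (zero_complex A) i j x) = cdiff X i j (\0 x) :> X j.
  exact/esym/(linear0 (cdiff X i j)).
pose g : chain_map (zero_complex A) X := @ChainMap A (zero_complex A) X (fun i => \0) g0.
exists f, g; split.
  exists (fun i j => (\- (h i j)) : {linear X i -> X j}) => i x.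
  by rewrite /= sub0r -[x in LHS]scale1r (hh i x) linearN opprD.
exists (fun i j => (\0 : {linear zero_complex A i -> zero_complex A j})) => i y.
by apply/rowP => -[].
Qed.

End BoundedHomotopies.

Section LocalComplexes.
Variables (A : comNzRingType) (m : submodClosed A^o).
Hypotheses (hA : noeth A^o) (hm : local_ring m).
Variable X : complex A.

(** With [K] the cocycles and [B] the coboundaries, two consecutive members of the
    decreasing sequence [B + c ^+ j K] agree, and Nakayama's lemma then gives
    [c ^+ j K `<=` B]. *)
Lemma finite_length_killed (c : A) i L : (c : A^o) \in m -> noeth (X i) ->
  lenle (imd X (i - 1) i) (kerd X i (i + 1)) L -> exists l, kills X (c ^+ l) i.
Proof.
move=> cm hX hL; set B := imd X (i - 1) i in hL; set K := kerd X i (i + 1) in hL.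
have hB : submod B by exact: submod_imd.
have hK : submod K by exact: submod_kerd.
pose S j := addS B (mulS (c ^+ j) K).
have hS j : submod (S j) by apply: submod_addS => //; exact: submod_mulS.
have SS j : S j.+1 `<=` S j.
  apply: addS_mono => // _ [v Kv ->]; exists (c *: v); first exact: submodZ.
  by rewrite scalerA exprSr.
have [j jS] : exists j, S j `<=` S j.+1.
  apply: contrapT => no; suff /hL : chain B K L.+1 by rewrite ltnn.
  exists (fun k => S (L.+1 - k)%N); split=> k kL.
    split=> //; first by apply: addSl; exact: submod_mulS.
    by apply: addS_sub => //; [exact: imd_kerd|exact: mulS_sub].
  have -> : (L.+1 - k)%N = (L.+1 - k.+1).+1 by lia.
  by split; [exact: SS|move=> h; apply: no; exists (L.+1 - k.+1)%N].
exists j; suff : mulS (c ^+ j) K `<=` B by move=> h z Kz; apply: h; exists z.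
apply: (nakayama hA hm hX (submod_mulS _ hK) hB) => U hU BU mU v Kv.
have /jS[x [_ [Bx [w Kw ->] ->]]] : S j v by apply: addSr.
apply: submodD => //; first exact: BU.
by rewrite exprS -scalerA; apply: mU => //; exists w.
Qed.

Lemma killsX (c : A) l l' i : (l <= l')%N -> kills X (c ^+ l) i -> kills X (c ^+ l') i.
Proof.
move=> /subnK <- h z hz; rewrite exprD -scalerA.
by apply: submodZ; [exact: submod_imd|exact: h].
Qed.

Hypothesis b : forall i, based (X i).
Hypothesis bX : bounded X.
Hypothesis nX : forall i, noeth (X i).

(** Let [t] be the highest degree with non-zero cohomology; there is one, since
    otherwise [X] would be contractible. Above [t] there is a contraction [h], and
    [id - h d] projects [X t] onto its cocycles. If every cocycle were a coboundary
    modulo [m X t], this projection would make it a coboundary modulo [m] times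
    the cocycles, and by Nakayama's lemma the cohomology at [t] would vanish. So
    some cocycle [x] is not a coboundary modulo [m X t]; a submodule [G] maximal
    among those that contain the coboundaries and [m X t] but not [x] has
    codimension one. *)
Lemma cocycle_outside : ~ homotopy_iso X (zero_complex A) ->
  exists t (x : X t) (G : set (X t)),
    [/\ submod G, imd X (t - 1) t `<=` G,
        forall (a : A) y, (a : A^o) \in m -> G (a *: y)
      & cdiff X t (t + 1) x = 0 /\ ~ G x /\ forall y, exists l : A, G (y - l *: x)].
Proof.
move=> nz; have [B [hB hB']] := bounded_above bX.
pose P k := forall i, B%:Z - k%:Z < i -> kills X 1 i.
have [k [Pk nPk]] : exists k, P k /\ ~ P k.+1.
  apply: contrapT => no; apply: nz; apply: contractible_iso.
  have allP k : P k.
    elim: k => [|k IH] i ik.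
      move=> z _; rewrite subr0 in ik; rewrite (hB i ik z) scaler0.
      exact: (submod0 (submod_imd X _ _)).
    by apply: contrapT => nk; apply: no; exists k; split=> // Pk1; apply: nk; exact: Pk1.
  have [|n [h hh]] := null_homotopy b bX (c := 1).
    by move=> i; apply: (allP (`|B%:Z - i|.+1)%N); lia.
  by exists h => i; have := hh i; rewrite expr1n.
set t := B%:Z - k%:Z.
have nt : ~ kills X 1 t.
  move=> ht; apply: nPk => i ik; have [->|it] := eqVneq i t; first by [].
  by apply: Pk; move: ik it; rewrite /t; lia.
have [h hh] := homotopy_above b hB Pk.
rewrite expr1n in hh.
pose e : {linear X t -> X t} := idfun \- (h (t + 1) t \o cdiff X t (t + 1)).
set K := kerd X t (t + 1); have hK : submod K by exact: submod_kerd.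
set D := imd X (t - 1) t; have hD : submod D by exact: submod_imd.
have eK x : K (e x).
  rewrite /K /kerd /= linearB /=.
  have := hh (t + 1) _ (cdiff X t (t + 1) x).
  rewrite addrK cdiffK linear0 addr0 scale1r => <-.
    by rewrite subrr.
  by rewrite /t; lia.
have eid x : K x -> e x = x by move=> Kx; rewrite /= Kx linear0 subr0.
pose mX := [set x | x \in submod_span
  [set z : X t | exists (a : A) y, (a : A^o) \in m /\ z = a *: y]].
have hmX : submod mX by exact: submod_span_set.
have hDm : submod (addS D mX) by exact: submod_addS.
have [x [Kx nGx]] : exists x, K x /\ ~ addS D mX x.
  apply: contrapT => no; apply: nt => z Kz; rewrite scale1r.
  suff : K `<=` D by apply.
  apply: (nakayama hA hm (@nX t) hK hD) => U hU DU mU v Kv.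
  have [y [w [Dy mw ev]]] : addS D mX v.
    by apply: contrapT => nv; apply: no; exists v.
  rewrite -(eid v Kv) ev linearD (eid y); last exact: (@imd_kerd _ X _ _ _ _ Dy).
  apply: submodD => //; first exact: DU.
  apply: (submod_span_sub (submod_preimage e hU) _ mw) => _ [a [u [am ->]]].
  suff : U (e (a *: u)) by [].
  by rewrite linearZ; exact: mU (eK u).
have [||G [[hG Gx] DG maxG]] :=
  noeth_maximal (@nX t) (F := [set S | submod S /\ ~ S x]) (S0 := addS D mX).
  by split.
  by move=> S [].
exists t, x, G; split=> //.
- by move=> y Dy; apply: DG; exact: addSl.
- move=> a y am; apply: DG; apply: addSr => //; apply: submod_span_mem.
  by exists a, y.
split=> //; split=> // y; have [Gy|Gy] := pselect (G y).
  by exists 0; rewrite scale0r subr0.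
have hl := submod_line y.
have [_ [g [[a _ <-] Gg e1]]] : addS (range (fun a : A => a *: y)) G x.
  apply: contrapT => nx; apply: Gy; apply: (maxG (addS (range (fun a : A => a *: y)) G)).
  - by split=> //; exact: submod_addS.
  - exact: addSr.
  - by apply: addSl => //; exists 1; rewrite ?scale1r.
have [d hd] : exists d, d * a = 1.
  apply: (local_unit hA hm); apply/negP => am; apply: Gx; rewrite e1.
  apply: submodD => //; apply: DG; apply: addSr => //; apply: submod_span_mem.
  by exists a, y.
exists d; rewrite e1 scalerDr scalerA hd scale1r opprD addrA subrr sub0r.
by apply: submodN => //; exact: submodZ.
Qed.

End LocalComplexes.

(** * Cohomology with coefficients in a subquotient *)

Lemma lenle_ffun (A : comNzRingType) (V : lmodType A) (a : nat) (R P : set V) l :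
  submod R -> submod P -> R `<=` P -> lenle R P l ->
  lenle [set v : {ffun 'I_a -> V} | forall k, R (v k)]
        [set v : {ffun 'I_a -> V} | forall k, P (v k)] (a * l).
Proof.
move=> hR hP RP hl.
pose U n := [set v : {ffun 'I_a -> V} |
  (forall k, P (v k)) /\ forall k : 'I_a, (n <= k)%N -> R (v k)].
have hU n : submod (U n).
  split.
  - by split=> k; rewrite ffunE => *; exact: submod0.
  - by move=> v w [v1 v2] [w1 w2]; split=> k; rewrite ffunE => *; apply: submodD; auto.
  - by move=> c v [v1 v2]; split=> k; rewrite ffunE => *; apply: submodZ; auto.
have UU n : U n `<=` U n.+1 by move=> v [v1 v2]; split=> // k /ltnW; exact: v2.
suff h n : (n <= a)%N -> lenle (U 0%N) (U n) (n * l).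
  apply: lenle_sub (h a (leqnn a)) => v /=; first by case=> _ hv k; exact: hv.
  by move=> hv; split=> // k; rewrite leqNgt ltn_ord.
elim: n => [_|n IH na]; first exact: lenle0.
rewrite mulSn addnC; apply: (lenle_add (hU n) _ (@UU n) (hU n.+1) (IH (ltnW na))).
  by move=> v [v1 v2]; split=> // k _; exact: v2.
pose i0 := Ordinal na.
have := lenle_corr (entry i0 : {linear {ffun 'I_a -> V} -> V}) l (hU n.+1) hR.
case=> _ h; apply: lenle_sub (h _) => //.
  move=> v [[v1 v2] vi]; split=> // k; rewrite leq_eqVlt => /orP[/eqP e|]; last exact: v2.
  by have -> : k = i0 by apply: val_inj.
by apply: lenle_sub hl => //; apply: addS_sub => // _ [v [v1 _] <-]; exact: v1.
Qed.

Section Functor.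
Variables (A : comNzRingType) (X : complex A) (b : forall i, based (X i)).

(** All cohomology modules of [X (x) P/R] have length at most [c]. The indices
    are kept apart so that no cast along [p - 1 + 1 = p] is needed. *)
Definition coh_le (W : lmodType A) (R P : set W) (c : nat) : Prop :=
  forall o p q, p = o + 1 -> q = p + 1 ->
    lenle (bnd b R P o p) (cyc b R P p q) c.

Section OneModule.
Variable W : lmodType A.
Implicit Types (R P : set W).

(** From the long exact sequence of [0 -> R/R0 -> P/R0 -> P/R -> 0]. *)
Lemma coh_le_sub R0 R P c c' : submod R0 -> submod R -> submod P ->
  R0 `<=` R -> R `<=` P -> coh_le R0 P c -> coh_le R P c' -> coh_le R0 R (c' + c).
Proof.
move=> hR0 hR hP R0R RP h h' o p q eo eq.
have R0P : R0 `<=` P by exact: subset_trans RP.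
have hcyc := submod_cyc b p q hR0 hR; have hB := submod_bnd b o p hR0 hR.
have hB' := submod_bnd b o p hR0 hP.
pose E := cyc b R0 R p q `&` bnd b R0 P o p.
have hE : submod E by exact: submodI.
have BE : bnd b R0 R o p `<=` E.
  move=> v hv; split; first exact: (@bnd_cyc _ _ _ _ R0 R o p q) hv.
  by move: v hv; apply: addS_mono => //; apply: image_subset => v hv k; exact: RP.
apply: (lenle_add hE BE _ hcyc); first by move=> v [].
  have hC := submod_cyc b o p hR hP.
  have [hcorr _] := lenle_corr (dm b o p : {linear vec (b o) W -> vec (b p) W}) c' hC hB.
  apply: lenle_sub (hcorr _) => //.
    move=> v [[vR _] [_ [r [[w wP <-] rR0 e]]]].
    exists (dm b o p w), r; split=> //; last first.
      by apply: addSr => //; exact: (submod_image (dm b o p) (submod_vin _ hR)).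
    exists w => //; split=> // k; have -> : dm b o p w = v - r by rewrite e addrK.
    by rewrite !ffunE; apply: submodB => //; apply: R0R.
  apply: lenle_sub (h' (o - 1) o p _ _); rewrite ?subrK //.
  move=> v hv; split; first exact: (@bnd_cyc _ _ _ _ R P (o - 1) o p) hv.
  have [_ [r [[w _ <-] rR ->]]] := hv; rewrite linearD /= dmK add0r.
  apply: addSl; first exact: submod_vin.
  by exists r.
apply: (proj2 (lenle_corr (idfun : {linear vec (b p) W -> vec (b p) W}) c hcyc hB')).
apply: lenle_sub (h o p q eo eq) => //; apply: addS_sub.
- exact: submod_cyc.
- by move=> _ [v [v1 v2] <-]; split=> // k; exact: RP.
- exact: bnd_cyc.
Qed.

(** Each term of [X (x) P/R] is a sum of at most [a] copies of [P/R]. *)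
Lemma coh_le_len a R P l : (forall p, (rk (b p) <= a)%N) ->
  submod R -> submod P -> R `<=` P -> lenle R P l -> coh_le R P (a * l).
Proof.
move=> ha hR hP RP hl o p q _ _.
apply: (@lenle_leq _ _ _ _ (rk (b p) * l)); first by rewrite leq_mul2r ha orbT.
have h : lenle (vin (b p) R) (vin (b p) P) (rk (b p) * l) := lenle_ffun hR hP RP hl.
apply: lenle_sub h.
  by apply: addSr; exact: (submod_image (dm b o p) (submod_vin (b o) hP)).
by move=> v [].
Qed.

End OneModule.

(** [X (x) W^n] is the sum of [n] copies of [X (x) W]. *)
Lemma coh_le_vin (W : lmodType A) (Q : lmodType A) (bQ : based Q) (J : set W) c :
  submod J -> coh_le J setT c -> coh_le (vin bQ J) setT (rk bQ * c).
Proof.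
move=> hJ h o p q eo eq; have hT := submodT W.
have hJ' := submod_vin bQ hJ; have hT' := submodT (vec bQ W).
pose tr (v : vec (b p) (vec bQ W)) : {ffun 'I_(rk bQ) -> vec (b p) W} :=
  [ffun k => [ffun i => v i k]].
have trlin : linear tr.
  by move=> a v w; apply/ffunP => k; apply/ffunP => i; rewrite !ffunE.
pose trL : {linear vec (b p) (vec bQ W) -> {ffun 'I_(rk bQ) -> vec (b p) W}} :=
  HB.pack tr (GRing.isLinear.Build A _ _ _ tr trlin).
pose Bs := [set v : {ffun 'I_(rk bQ) -> vec (b p) W} | forall k, bnd b J setT o p (v k)].
pose Cs := [set v : {ffun 'I_(rk bQ) -> vec (b p) W} | forall k, cyc b J setT p q (v k)].
have hB := submod_bnd b o p hJ hT; have hC := submod_cyc b p q hJ hT.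
have BC := @bnd_cyc _ _ b _ J setT o p q hJ hT (@subsetT _ J).
have hl : lenle Bs Cs (rk bQ * c) := lenle_ffun hB hC BC (h o p q eo eq).
have hBs : submod Bs.
  split=> [k|v w hv hw k|a v hv k]; rewrite ffunE;
    [exact: submod0|exact: submodD|exact: submodZ].
have hcyc := submod_cyc b p q hJ' hT'.
apply: (@lenle_sub _ _ [set v | cyc b (vin bQ J) setT p q v /\ Bs (trL v)]
  _ _ _ _ _ (@subset_refl _ _)).
  move=> v [_ hv].
  have [|u hu] := @choice _ _ (fun k x => vin (b p) J (tr v k - dm b o p x)).
    move=> k; have [_ [r [[w _ <-] hr e]]] := hv k; exists w.
    by rewrite [tr v k]e addrC addKr.
  pose w : vec (b o) (vec bQ W) := [ffun i => [ffun k => u k i]].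
  exists (dm b o p w), (v - dm b o p w); split; first by exists w.
    move=> i k; have := hu k i; rewrite !ffunE => hJk.
    suff -> : (\sum_j (crd (b p) i (cdiff X o p (bas (b o) j)) : A) *: w j) k =
              \sum_j (crd (b p) i (cdiff X o p (bas (b o) j)) : A) *: u k j by [].
    by rewrite sum_ffunE; apply: eq_bigr => j _; rewrite !ffunE.
  by rewrite addrC subrK.
apply/(lenle_corr trL (rk bQ * c) hcyc hBs); apply: lenle_sub hl => //.
apply: addS_sub.
- split=> [k|v w hv hw k|a v hv k]; rewrite ffunE;
    [exact: submod0|exact: submodD|exact: submodZ].
- move=> _ [v [_ hv] <-] k; split=> // i; have := hv i k; rewrite !ffunE.
  rewrite sum_ffunE; congr (J _); apply: eq_bigr => j _; by rewrite !ffunE.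
- by move=> v hv k; exact: BC.
Qed.

(** [f] identifies [P / (P :&: f^-1 R')] with [(f P + R') / R']: the bound depends on
    the subquotient only, not on the module in which it is presented. *)
Lemma coh_le_corr (W W' : lmodType A) (f : {linear W -> W'}) (P : set W) (R' : set W') c :
  submod P -> submod R' -> coh_le R' (addS (f @` P) R') c ->
  coh_le [set v | P v /\ R' (f v)] P c.
Proof.
move=> hP hR' h o p q eo eq.
set R := [set v | _]; set P' := addS _ _ in h.
have hR : submod R := submodI hP (submod_preimage f hR').
have RP : R `<=` P by move=> v [].
have hP' : submod P' := submod_addS (submod_image f hP) hR'.
have RP' : R' `<=` P' := addSr (submod_image f hP).
have hC := submod_cyc b p q hR hP; have hB' := submod_bnd b o p hR' hP'.
apply: (@lenle_sub _ _ [set v | cyc b R P p q v /\ bnd b R' P' o p (vmap f v)]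
  _ _ _ _ _ (@subset_refl _ _)).
  move=> v [[vP _] [_ [r [[w' hw' <-] hr e]]]].
  have [|w hw] := @choice _ _ (fun i x => P x /\ R' (w' i - f x)).
    move=> i; have [_ [y [[x Px <-] Ry ex]]] := hw' i.
    by exists x; split=> //; rewrite ex addrC addKr.
  pose wv : vec (b o) W := [ffun i => w i].
  have hwv : vin (b o) P wv by move=> i; rewrite ffunE; have [] := hw i.
  exists (dm b o p wv), (v - dm b o p wv); split; first by exists wv.
    move=> i; rewrite /vin /= !ffunE; split.
      apply: submodB => //; apply: submod_sum => // j _; apply: submodZ => //.
    have -> : f (v i - \sum_j (crd (b p) i (cdiff X o p (bas (b o) j)) : A) *: wv j) =
              r i + \sum_j (crd (b p) i (cdiff X o p (bas (b o) j)) : A) *: (w' j - f (w j)).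
      have /ffunP /(_ i) := e; rewrite !ffunE => ei.
      rewrite linearB ei addrC addrA addrC; congr (_ + _).
      rewrite linear_sum -sumrN -big_split; apply: eq_bigr => j _ /=.
      by rewrite ffunE linearZ scalerBr addrC.
    apply: submodD => //; apply: submod_sum => // j _; apply: submodZ => //.
    by have [] := hw j.
  by rewrite addrC subrK.
apply/(lenle_corr (vmap f : {linear vec (b p) W -> vec (b p) W'}) c hC hB').
apply: lenle_sub (h o p q eo eq) => //; apply: addS_sub.
- exact: submod_cyc.
- move=> _ [v [v1 v2] <-]; split=> [i|].
    by rewrite ffunE; apply: addSl => //; exists (v i).
  rewrite /dm mact_vmap => i; rewrite ffunE.
  by have [] := v2 i.
- exact: bnd_cyc.
Qed.

End Functor.

Section Residue.
Variables (A : comNzRingType) (m : submodClosed A^o).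
Hypotheses (hA : noeth A^o) (hm : local_ring m).
Variables (X : complex A) (b : forall i, based (X i)).
Hypotheses (bX : bounded X) (nX : forall i, noeth (X i)).
Hypothesis nz : ~ homotopy_iso X (zero_complex A).

(** With [x] a cocycle and [lam : X -> A/m] a cochain map such that
    [lam x = 1], the composite [P -> H(X (x) P) -> P / m P] of [x (x) _] and
    [lam (x) id] is the canonical projection. *)
Lemma coh_le_residue (W : lmodType A) (R U P : set W) c :
  submod R -> submod P -> R `<=` U -> submod U -> U `<=` P ->
  (forall (a : A) v, (a : A^o) \in m -> P v -> U (a *: v)) ->
  coh_le b R P c -> lenle U P c.
Proof.
move=> hR hP RU hU UP mU h.
have [t [x [G [hG DG mG [dx [nGx hlam]]]]]] := cocycle_outside hA hm b bX nX nz.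
have [lam lamE] := choice (fun i => hlam (bas (b t) i)).
pose Lam (y : X t) := \sum_i (crd (b t) i y : A) * lam i.
have GL y : G (y - Lam y *: x).
  rewrite -{1}(crdE (b t) y) /Lam scaler_suml -sumrB; apply: submod_sum => // i _.
  by rewrite -scalerA -scalerBr; exact: submodZ.
have Gm (a : A) : G (a *: x) -> (a : A^o) \in m.
  move=> Gax; apply/negPn/negP => am; have [d hd] := local_unit hA hm am.
  by apply: nGx; rewrite -(scale1r x) -hd -scalerA; exact: submodZ.
have Lm y : G y -> (Lam y : A^o) \in m.
  move=> Gy; apply: Gm; have -> : Lam y *: x = y - (y - Lam y *: x) by rewrite subKr.
  exact: submodB.
have [d hd] : exists d, d * Lam x = 1.
  have m1 : ((1 - Lam x : A) : A^o) \in m.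
    by apply: Gm; rewrite scalerBl scale1r.
  have [d hd] := local_1B hA hm m1; exists d.
  by rewrite -[RHS]hd; congr (_ * _); rewrite opprB addrC subrK.
pose f : W -> vec (b t) W := pure (b t) x.
pose fL : {linear W -> vec (b t) W} :=
  HB.pack f (GRing.isLinear.Build A _ _ _ f (pure_linearr (b t) x)).
have hB := submod_bnd b (t - 1) t hR hP.
have RP : R `<=` P by exact: subset_trans UP.
apply: (@lenle_sub _ _ [set u | P u /\ bnd b R P (t - 1) t (fL u)]
  _ _ _ _ _ (@subset_refl _ _)).
  move=> u [Pu [_ [r [[w wP <-] rR e]]]].
  have lamD (v v' : vec (b t) W) : \sum_i lam i *: (v + v') i =
      \sum_i lam i *: v i + \sum_i lam i *: v' i.
    by rewrite -big_split; apply: eq_bigr => i _; rewrite ffunE scalerDr.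
  have lampure : \sum_i lam i *: (f u) i = Lam x *: u.
    rewrite scaler_suml; apply: eq_bigr => i _.
    by rewrite ffunE scalerA mulrC.
  have lamd : U (\sum_i lam i *: (dm b (t - 1) t w) i).
    under eq_bigr do rewrite ffunE scaler_sumr.
    rewrite exchange_big; apply: submod_sum => // j _ /=.
    set y := cdiff X (t - 1) t (bas (b (t - 1)) j).
    have -> : \sum_i lam i *: ((crd (b t) i y : A) *: w j) = Lam y *: w j.
      by rewrite scaler_suml; apply: eq_bigr => i _; rewrite scalerA mulrC.
    by apply: mU => //; apply: Lm; apply: DG; exists (bas (b (t - 1)) j).
  rewrite -(scale1r u) -hd -scalerA -lampure; apply: submodZ => //.
  have -> : f u = dm b (t - 1) t w + r := e.
  rewrite lamD; apply: submodD => //; apply: submod_sum => // i _.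
  by apply: submodZ => //; apply: RU.
apply/(lenle_corr fL c hP hB).
apply: lenle_sub (h (t - 1) t (t + 1) _ erefl) => //; last by rewrite subrK.
apply: addS_sub; first exact: submod_cyc.
  move=> _ [u Pu <-]; split=> [i|]; first by rewrite ffunE; exact: submodZ.
  have -> : dm b t (t + 1) (fL u) = pure (b (t + 1)) (cdiff X t (t + 1) x) u.
    exact: mact_pure.
  by rewrite dx => i; rewrite ffunE linear0 scale0r; exact: submod0.
exact: bnd_cyc.
Qed.

End Residue.

(** * Bounded complexes with cohomology of finite length *)

Section BoundedComplex.
Variables (A : comNzRingType) (X : complex A) (b : forall i, based (X i)).
Hypothesis bX : bounded X.

Lemma rk_eq0 (P : lmodType A) (bP : based P) : (forall x : P, x = 0) -> rk bP = 0%N.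
Proof.
move=> h; apply/eqP; rewrite -leqn0 leqNgt; apply/negP => r0.
have := crd_bas bP (Ordinal r0) (Ordinal r0); rewrite eqxx (h (bas bP _)) linear0.
by move/esym/eqP; rewrite oner_eq0.
Qed.

Lemma uniform_degree (P : int -> nat -> Prop) :
  (forall i n n', (n <= n')%N -> P i n -> P i n') ->
  (forall i, (forall x : X i, x = 0) -> P i 0%N) ->
  (forall i, exists n, P i n) -> exists n, forall i, P i n.
Proof.
move=> mono triv ex; have [B [hB hB']] := bounded_above bX.
have [||n hn] := @uniform_bound (fun k n => P (k%:Z - B%:Z) n) (B + B).
- by move=> k n n'; exact: mono.
- by move=> k _; exact: ex.
exists n => i; have [iB|iB] := ltrP i (- B%:Z).
  by apply: (mono _ 0%N) => //; apply: triv; exact: hB'.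
have [Bi|Bi] := ltrP B%:Z i.
  by apply: (mono _ 0%N) => //; apply: triv; exact: hB.
have -> : i = (absz (i + B%:Z))%:Z - B%:Z by lia.
by apply: hn; lia.
Qed.

Lemma rk_bounded : exists a, forall p, (rk (b p) <= a)%N.
Proof.
apply: (uniform_degree (P := fun p a => (rk (b p) <= a)%N)).
- by move=> i n n' nn' h; exact: leq_trans nn'.
- by move=> i /rk_eq0 ->.
- by move=> i; exists (rk (b i)).
Qed.

Lemma homotopy_kills (h : forall i j, {linear X i -> X j}) (c : A) p
    (W : lmodType A) (R P : set W) : homotopy_at h c p ->
  submod R -> submod P -> mulS c (cyc b R P p (p + 1)) `<=` bnd b R P (p - 1) p.
Proof.
move=> hh hR hP _ [v [vP vR] ->].
exists (dm b (p - 1) p (mact (b (p - 1)) (h p (p - 1)) v)),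
  (mact (b p) (h (p + 1) p) (dm b p (p + 1) v)); split.
- by exists (mact (b (p - 1)) (h p (p - 1)) v) => //; exact: mact_vin.
- exact: mact_vin.
- rewrite -(mact_scale c v) (mact_ext _ v hh) mactD.
  by congr (_ + _); exact: mact_comp.
Qed.

Variable m : submodClosed A^o.
Hypotheses (hA : noeth A^o) (hm : local_ring m).
Hypothesis nX : forall i, noeth (X i).
Hypothesis fX : forall i, exists L, lenle (imd X (i - 1) i) (kerd X i (i + 1)) L.

(** Finite length makes a power of [c] act as zero on the cohomology of [X],
    hence a further power null-homotopic on [X]; it then kills the cohomology of
    [X (x) P/R] whatever [P] and [R] are. *)
Lemma nilpotent_cohomology (cs : seq A) : (forall c, c \in cs -> (c : A^o) \in m) ->
  exists e, forall c, c \in cs -> forall (W : lmodType A) (R P : set W),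
    submod R -> submod P -> forall o p q, p = o + 1 -> q = p + 1 ->
    mulS (c ^+ e) (cyc b R P p q) `<=` bnd b R P o p.
Proof.
pose K c e := forall (W : lmodType A) (R P : set W), submod R -> submod P ->
  forall o p q, p = o + 1 -> q = p + 1 ->
  mulS (c ^+ e) (cyc b R P p q) `<=` bnd b R P o p.
have mono c e e' : (e <= e')%N -> K c e -> K c e'.
  move=> /subnK <- h W R P hR hP o p q eo eq _ [v hv ->]; rewrite exprD -scalerA.
  by apply: submodZ; [exact: submod_bnd|apply: (h W R P hR hP o p q eo eq); exists v].
have one c : (c : A^o) \in m -> exists e, K c e.
  move=> cm; have [|||l hl] := @uniform_degree (fun i l => kills X (c ^+ l) i).
  - by move=> i n n' nn'; exact: killsX.
  - by move=> i x0 z _; rewrite (x0 (_ *: z)); exact: (submod0 (submod_imd X _ _)).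
  - move=> i; have [L hL] := fX i.
    exact: (finite_length_killed hA hm cm (@nX i) hL).
  have [k [h hh]] := null_homotopy b bX hl.
  exists (l * k)%N => W R P hR hP o p q eo eq; rewrite exprM eq.
  have -> : o = p - 1 by rewrite eo addrK.
  exact: homotopy_kills.
elim: cs => [_|c cs IH hcs]; first by exists 0%N.
have [|e1 h1] := one c; first by apply: hcs; exact: mem_head.
have [|e2 h2] := IH; first by move=> d ds; apply: hcs; rewrite inE ds orbT.
exists (maxn e1 e2) => d; rewrite inE => /predU1P[->|/h2].
  exact: mono (leq_maxl _ _) h1.
exact: mono (leq_maxr _ _).
Qed.

Lemma coordinates_finite (W : lmodType A) (J : set W) o p q :
  fin_gen W -> (exists cs : seq A^o, spanS cs = [set x | x \in m]) -> submod J ->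
  p = o + 1 -> q = p + 1 -> exists n, lenle (bnd b J setT o p) (cyc b J setT p q) n.
Proof.
move=> fW [cs hcs] hJ eo eq; have hT := submodT W.
have csm c : c \in cs -> (c : A^o) \in m.
  by move=> ccs; have : spanS cs c := spanS_mem ccs; rewrite hcs.
have [e he] := nilpotent_cohomology csm.
have hB := submod_bnd b o p hJ hT; have hC := submod_cyc b p q hJ hT.
have BC := @bnd_cyc _ _ b _ J setT o p q hJ hT (@subsetT _ J).
have nV : noeth (vec (b p) W) by exact: (noeth_ffun hA fW).
have [s es] := nV _ hC.
have hU : submod (addS (bnd b J setT o p) (scalS cs (cyc b J setT p q))).
  by apply: submod_addS => //; exact: submod_scalS.
exists (e ^ size cs * size s)%N; apply: (lenle_nilpotents hC hB BC) => [c ccs|].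
  exact: he.
have h : lenle (addS (bnd b J setT o p) (scalS cs (cyc b J setT p q)))
   (addS (spanS s) (addS (bnd b J setT o p) (scalS cs (cyc b J setT p q)))) (size s).
  apply: (lenle_span hA hm hU) => a x am xs; apply: addSr => //.
  apply: (scalS_span hC); first by rewrite hcs.
  by have := spanS_mem xs; rewrite -es.
by apply: lenle_sub h => //; rewrite {1}es; exact: addSl.
Qed.

End BoundedComplex.

(** * The comparison theorem *)

Section Comparison.
Variables (A : comNzRingType) (m : submodClosed A^o).
Hypotheses (hA : noeth A^o) (hm : local_ring m).
Variables (X Y : complex A) (bX : forall i, based (X i)) (bY : forall i, based (Y i)).
Hypotheses (boX : bounded X) (boY : bounded Y).
Hypotheses (nX : forall i, noeth (X i)) (nY : forall i, noeth (Y i)).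
Hypothesis nzX : ~ homotopy_iso X (zero_complex A).
Hypothesis fY : forall i, exists L, lenle (imd Y (i - 1) i) (kerd Y i (i + 1)) L.

(** Write [N = M/J] and let [C q], [B q], [H q] be the cocycles, coboundaries and
    cohomology of [Y (x) N]; let [h T] be the largest length of a cohomology
    module of [X (x) T]. Downward induction on [q] bounds [h (C q)] and the
    length of [H q] by a multiple of [h N] that is independent of [J]. From
    degree [q + 1] one gets [h (H (q + 1))], then [h (B (q + 1))], and then
    [h (C q)], as [B (q + 1)] is [Y^q (x) N] modulo [C q]. By [coh_le_residue] this
    bounds the length of [C q / m C q], so that of [H q / m H q], and therefore
    that of [H q], which is killed by fixed powers of generators of [m]. *)
Lemma comparison (M : lmodType A) : exists K, forall (J : set M) c, submod J ->
  coh_le bX J setT c -> forall o p q, p = o + 1 -> q = p + 1 ->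
  lenle (bnd bY J setT o p) (cyc bY J setT p q) (K * c).
Proof.
have [cs hcs] := hA (submodClosedP m).
have csm c : c \in cs -> (c : A^o) \in m.
  by move=> ccs; have : spanS cs c := spanS_mem ccs; rewrite -hcs.
have [e he] := nilpotent_cohomology bY boY hA hm nY fY csm.
have [a ha] := rk_bounded bX boX.
have hT := submodT M.
pose St p K := forall (J : set M) c, submod J -> coh_le bX J setT c ->
  forall o q, p = o + 1 -> q = p + 1 ->
  coh_le bX (vin (bY p) J) (cyc bY J setT p q) (K * c) /\
  lenle (bnd bY J setT o p) (cyc bY J setT p q) (K * c).
have mono p K K' : (K <= K')%N -> St p K -> St p K'.
  move=> KK h J c hJ hc o q eo eq; have [h1 h2] := h J c hJ hc o q eo eq.
  have le : (K * c <= K' * c)%N by rewrite leq_mul2r KK orbT.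
  split; last exact: lenle_leq h2.
  by move=> o' p' q' eo' eq'; exact: lenle_leq (h1 o' p' q' eo' eq').
have triv p : (forall x : Y p, x = 0) -> St p 0%N.
  move=> /(rk_eq0 (bY p)) r0 J c hJ hc o q eo eq.
  have all0 (v w : vec (bY p) M) : v = w.
    by apply/ffunP => i; have := ltn_ord i; rewrite {2}r0.
  have hB := submod_bnd bY o p hJ hT; rewrite mul0n.
  split; last by apply: lenle0 => v _; rewrite (all0 v 0); exact: submod0.
  move=> o' p' q' _ _; apply: lenle0 => v _.
  have hC := submod_cyc bY p q hJ hT.
  have -> : v = 0 by apply/ffunP => i; exact: all0.
  exact: submod0 (submod_bnd bX o' p' (submod_vin _ hJ) hC).
have step p q : q = p + 1 -> (exists K, St q K) -> exists K, St p K.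
  move=> eq [K hK].
  pose K1 := (a * K + K + rk (bY p))%N.
  exists (K1 + e ^ size cs * K1)%N => J c hJ hc o q' eo.
  rewrite -eq => ->.
  have [h1 h2] := hK J c hJ hc p (q + 1) eq erefl.
  have hJp := submod_vin (bY p) hJ; have hJq := submod_vin (bY q) hJ.
  have hC1 := submod_cyc bY q (q + 1) hJ hT; have hB1 := submod_bnd bY p q hJ hT.
  have BC1 := @bnd_cyc _ _ bY _ J setT p q (q + 1) hJ hT (@subsetT _ J).
  have hC := submod_cyc bY p q hJ hT; have hB := submod_bnd bY o p hJ hT.
  have BC := @bnd_cyc _ _ bY _ J setT o p q hJ hT (@subsetT _ J).
  have JB1 : vin (bY q) J `<=` bnd bY J setT p q.
    exact: addSr (submod_image (dm bY p q) (submod_vin (bY p) hT)).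
  have JB : vin (bY p) J `<=` bnd bY J setT o p.
    exact: addSr (submod_image (dm bY o p) (submod_vin (bY o) hT)).
  (* Bounds for [h] of [H q], [B q], [(Y^p (x) N) / C p], [Y^p (x) N] and [C p]. *)
  have b1 := coh_le_len ha hB1 hC1 BC1 h2.
  have b2 := coh_le_sub hJq hB1 hC1 JB1 BC1 h1 b1.
  have b3 : coh_le bX (cyc bY J setT p q) (vin (bY p) setT) (a * (K * c) + K * c).
    exact: (@coh_le_corr _ _ bX _ _ (dm bY p q) _ _ _ (submod_vin (bY p) hT) hJq b2).
  have b4 : coh_le bX (vin (bY p) J) (vin (bY p) setT) (rk (bY p) * c).
    have -> : vin (bY p) setT = [set: vec (bY p) M] by apply/seteqP; split.
    exact: coh_le_vin.
  have b5 : coh_le bX (vin (bY p) J) (cyc bY J setT p q) (K1 * c).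
    have -> : (K1 * c)%N = (a * (K * c) + K * c + rk (bY p) * c)%N.
      by rewrite /K1 !mulnDl mulnA.
    apply: (coh_le_sub hJp hC (submod_vin (bY p) hT) _ _ b4 b3); last by move=> v [].
    exact: subset_trans JB BC.
  split.
    move=> o1 p1 q1 eo1 eq1; apply: lenle_leq (b5 o1 p1 q1 eo1 eq1).
    by rewrite mulnDl leq_addr.
  apply: (@lenle_leq _ _ _ _ (e ^ size cs * (K1 * c))%N).
    by rewrite mulnDl mulnA leq_addl.
  have hU : submod (addS (bnd bY J setT o p) (scalS cs (cyc bY J setT p q))).
    by apply: submod_addS => //; exact: submod_scalS.
  apply: (lenle_nilpotents hC hB BC) => [d dcs|]; first exact: he.
  apply: (coh_le_residue hA hm boX nX nzX hJp hC _ hU _ _ b5).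
  - by move=> v /JB; apply: addSl; exact: submod_scalS.
  - by apply: addS_sub => //; apply: scalS_sub => // d v _; exact: submodZ.
  - move=> d v dm' hv; apply: addSr => //.
    by apply: (scalS_span hC _ hv); rewrite -hcs.
have all p : exists K, St p K.
  have [B [hB _]] := bounded_above boY.
  have up i : B%:Z < i -> exists K, St i K by move=> iB; exists 0%N; apply/triv/hB.
  have [/up //|pB] := ltrP B%:Z p.
  have -> : p = (B.+1%:Z) - (absz (B.+1%:Z - p))%:Z by lia.
  elim: (absz _) => [|n]; first by apply: up; lia.
  by apply: step; lia.
have [K hK] := uniform_degree boY mono triv all.
exists K => J c hJ hc o p q eo eq.
by have [] := hK p J c hJ hc o q eo eq.
Qed.

End Comparison.

(** * The function psi *)

Section Psi.
Variables (A : comNzRingType) (m : submodClosed A^o).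
Hypotheses (hA : noeth A^o) (hm : local_ring m).
Variables (M : lmodType A) (fM : fin_gen M).
Variables (I : submodClosed A^o) (gI : seq A^o).
Hypothesis hI : [set a | a \in I] = spanS gI.

(** [I^n M], computed from generators of [I]. *)
Definition Jn n : set M := powS [set: M] (gI : seq A) n.

Lemma submod_Jn n : submod (Jn n).
Proof. exact: submod_powS. Qed.

Lemma Jn_mul c n v : c \in (gI : seq A) -> Jn n v -> Jn n.+1 (c *: v).
Proof. by move=> cI hv; apply: scalS_mem => //; exact: submod_Jn. Qed.

Lemma Jn_dec n : Jn n.+1 `<=` Jn n.
Proof.
elim: n => [//|n IH]; apply: scalS_sub; first exact: submod_Jn.
by move=> c v cI /IH; exact: Jn_mul.
Qed.

Lemma Jn_quo n : [set x | x \in submod_span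
    [set z : M | exists a x, a \in ideal_exp I n /\ z = a *: x]] = Jn n.
Proof.
elim: n => [|n IH].
  apply/seteqP; split=> // x _; apply: submod_span_mem.
  by exists 1, x; rewrite scale1r.
have aJ a x : a \in ideal_exp I n -> Jn n ((a : A) *: x).
  by move=> ha; rewrite -IH; apply: submod_span_mem; exists a, x.
apply/seteqP; split.
  apply: (submod_span_sub (submod_Jn n.+1)) => _ [a [x [ha ->]]].
  have hS : submod [set a : A^o | Jn n.+1 ((a : A) *: x)].
    have hJ := submod_Jn n.+1; split=> [|u v|c u] /=.
    - by rewrite scale0r; exact: submod0.
    - by rewrite scalerDl; exact: submodD.
    - by rewrite -scalerA; exact: submodZ.
  apply: (submod_span_sub hS _ ha) => _ [u [v [uI hv ->]]] /=.
  rewrite -scalerA; apply: (@scalS_span _ _ gI); [exact: submod_Jn| |exact: aJ].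
  by rewrite -hI.
have S := @submod_span_set _ _
  [set z : M | exists a x, a \in ideal_exp I n.+1 /\ z = a *: x].
apply: (@scalS_sub _ _ _ (Jn n) _ S) => c v cI.
have hf := submod_preimage (c \*: idfun : {linear M -> M}) S.
rewrite -IH; apply: (submod_span_sub hf) => _ [a [x [ha ->]]].
rewrite /preimage /= scalerA; apply: submod_span_mem; exists (c * a), x; split=> //.
apply: submod_span_mem; exists c, a; split=> //.
by have := @spanS_mem A A^o gI c cI; rewrite -hI.
Qed.

Section OneComplex.
Variables (X : complex A) (b : forall i, based (X i)).
Hypothesis bX : bounded X.
Hypothesis nX : forall i, noeth (X i).
Hypothesis fX : forall i, exists L, lenle (imd X (i - 1) i) (kerd X i (i + 1)) L.

(** The length of [H^p(X (x) M/I^n M)] when [o = p - 1] and [q = p + 1]. *)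
Definition hlen n o p q : nat := len (bnd b (Jn n) setT o p) (cyc b (Jn n) setT p q).

Lemma bnd_cycJ n o p q : bnd b (Jn n) setT o p `<=` cyc b (Jn n) setT p q.
Proof. exact: bnd_cyc (submod_Jn n) (submodT M) (@subsetT _ _). Qed.

Lemma hlen_finite n o p q : p = o + 1 -> q = p + 1 ->
  exists k, lenle (bnd b (Jn n) setT o p) (cyc b (Jn n) setT p q) k.
Proof.
apply: (coordinates_finite b bX hA hm nX fX fM); last exact: submod_Jn.
by have [s hs] := hA (submodClosedP m); exists s.
Qed.

Lemma hlen_lenle n o p q : p = o + 1 -> q = p + 1 ->
  lenle (bnd b (Jn n) setT o p) (cyc b (Jn n) setT p q) (hlen n o p q).
Proof.
move=> eo eq; have [k hk] := hlen_finite n eo eq.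
apply: lenleP hk; last exact: bnd_cycJ.
exact: submod_bnd (submod_Jn n) (submodT M).
Qed.

Lemma cohomology_hlen n i :
  mod_length (cohomology (tensor_complex X (quo_exp M I n)) i) = hlen n (i - 1) i (i + 1).
Proof.
rewrite mod_lengthE; apply: len_eq => //.
- by move=> k; rewrite /hlen -Jn_quo; exact: tensor_cohomology_lenle.
- exact: submod_set0.
- exact: submod_bnd (submod_Jn n) (submodT M).
- exact: bnd_cycJ.
Qed.

Lemma powS_linear (V : lmodType A) (f : {linear M -> V}) n x :
  Jn n x -> powS setT (gI : seq A) n (f x).
Proof.
elim: n x => [//|n IH] x hx.
have hS := submod_preimage f (submod_powS (submodT V) gI n.+1).
apply: (scalS_sub hS _ hx) => c v cI hv; rewrite /preimage /= linearZ /=.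
by apply: scalS_mem => //; [exact: submod_powS|exact: IH].
Qed.

Lemma vin_powS p n : vin (b p) (Jn n) `<=` powS setT (gI : seq A) n.
Proof.
move=> v hv; rewrite -(sum_single v); apply: submod_sum; first exact: submod_powS.
by move=> i _; exact: (powS_linear (single i : {linear M -> vec (b p) M})).
Qed.

Lemma nondecreasing_bounded (f : nat -> nat) c : (forall n, (f n <= f n.+1)%N) ->
  (forall n, (f n <= c)%N) -> exists n0, forall n, (n0 <= n)%N -> f n = f n0.
Proof.
move=> inc bd.
have mono i j : (i <= j)%N -> (f i <= f j)%N.
  move=> /subnK <-; elim: (j - i)%N => // k IH; rewrite addSn.
  exact: leq_trans (inc _).
pose P k := `[< exists n, f n = k >].
have [||k /asboolP[n0 <-] max] := @ex_maxnP P c.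
- by exists (f 0%N); apply/asboolP; exists 0%N.
- by move=> k /asboolP[n <-].
exists n0 => n nn; apply/eqP; rewrite eqn_leq; apply/andP; split; last exact: mono.
by apply: max; apply/asboolP; exists n.
Qed.

(** With [F = X (x) M], [J = I^n M], [K = ker d] and [D = im d], the cohomology
    of [F/J F] is an extension of [(J F :&: d F) / d (J F)] by
    [K / (D + (K :&: J F))]. The first is a graded piece of a Rees module; the
    length of the second is monotone in [n] and bounded by that of [K / D]. *)
Lemma hlen_evpoly o p q : p = o + 1 -> q = p + 1 ->
  evpoly (fun n => (hlen n o p q)%:R).
Proof.
move=> eo eq.
pose F r := vin (b r) [set: M].
have hT := submodT M.
pose K : set (vec (b p) M) := [set v | dm b p q v = 0].
have hK : submod K :=
  submod_preimage (dm b p q : {linear vec (b p) M -> vec (b q) M}) (submod_set0 _).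
pose B n := bnd b (Jn n) setT o p; pose C n := cyc b (Jn n) setT p q.
have hB n : submod (B n) := submod_bnd b o p (submod_Jn n) hT.
have hC n : submod (C n) := submod_cyc b p q (submod_Jn n) hT.
have hv r n := submod_vin (b r) (submod_Jn n).
pose T n := dm b p q @` vin (b p) (Jn n).
have hTn n : submod (T n) := submod_image (dm b p q) (hv p n).
pose S n := addS (dm b p q @` C n) (T n).
have hS n : submod (S n) := submod_addS (submod_image (dm b p q) (hC n)) (hTn n).
pose E n := addS K (B n).
have hE n : submod (E n) := submod_addS hK (hB n).
have KC n : K `<=` C n.
  by move=> v hv0; split=> // k; rewrite hv0 ffunE; exact: (submod0 (submod_Jn n)).
have EC n : E n `<=` C n by apply: addS_sub => //; exact: bnd_cycJ.
have e1 n : len (E n) (C n) = len (T n) (S n).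
  rewrite -(len_corr (dm b p q : {linear vec (b p) M -> vec (b q) M}) (hC n) (hTn n)).
  congr (len _ _); apply/seteqP; split=> v.
    move=> Ev; split; first exact: EC.
    have [x [_ [Kx [_ [r [[w _ <-] hr ->]]] ->]]] := Ev; exists r => //.
    by rewrite !linearD /= [dm b p q x]Kx dmK !add0r.
  case=> Cv [r hr e]; exists (v - r), r; split; last by rewrite subrK.
    by rewrite /K /= linearB /= -e subrr.
  by apply: addSr => //; exact: (submod_image (dm b o p) (submod_vin (b o) hT)).
have e2 n : len (B n) (E n) = len [set v | K v /\ B n v] K.
  have := len_corr (idfun : {linear vec (b p) M -> vec (b p) M}) hK (hB n).
  by rewrite image_id => ->.
have fin n : exists k, lenle (B n) (C n) k by exact: hlen_finite.
have e n : hlen n o p q = (len [set v | K v /\ B n v] K + len (T n) (S n))%N.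
  have [k hk] := fin n.
  rewrite -e1 -e2; apply: (len_add _ _ _ _ _ hk) => //; exact: addSr.
have [c hc] : exists c, forall n, lenle [set v | K v /\ B n v] K c.
  have fg : exists cs : seq A^o, spanS cs = [set x | x \in m].
    by have [cs hcs] := hA (submodClosedP m); exists cs.
  have [c hc] := coordinates_finite b bX hA hm nX fX fM fg (submod_set0 M) eo eq.
  exists c => n; apply: lenle_sub hc.
    apply: addS_sub; first exact: submodI hK (hB n).
      move=> _ [w _ <-]; split; first exact: dmK.
      by apply: addSl => //; exists w.
    move=> v hv0; have -> : v = 0 by apply/ffunP => k; rewrite hv0 ffunE.
    exact: (submod0 (submodI hK (hB n))).
  by move=> v Kv; split=> // k; rewrite Kv ffunE.
have hKB n : submod [set v | K v /\ B n v] := submodI hK (hB n).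
have KBK n : [set v | K v /\ B n v] `<=` K by move=> v [].
have [||n0 hn0] := @nondecreasing_bounded (fun n => len [set v | K v /\ B n v] K) c.
- move=> n; apply: len_le => //.
  apply: lenle_sub (lenleP (hKB n.+1) (KBK n.+1) (hc n.+1)) => //.
  move=> v [Kv Bv]; split=> //; move: Bv; apply: addS_mono => // w hw k.
  exact: Jn_dec.
- by move=> n; exact: len_le (hc n).
apply: (@evpoly_eq _
  (fun n => (len [set v | K v /\ B n0 v] K)%:R + (len (T n) (S n))%:R) n0).
  by move=> n nn; rewrite e hn0 // natrD.
apply: evpolyD; first exact: evpoly_const.
have nq : noeth (vec (b q) M) by exact: (noeth_ffun hA fM).
apply: (@hilbert_function _ _ nq setT (submodT _) (gI : seq A) (gI : seq A) S T) => //.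
- by move=> n; exact: addSr (submod_image _ (hC n)).
- move=> n; apply: subset_trans (@vin_powS q n); apply: addS_sub => //.
    by move=> _ [v [_ hv0] <-].
  by move=> _ [v hv0 <-]; exact: mact_vin (submod_Jn n) hv0.
- move=> r n v rI [_ [_ [[x hx <-] [y hy <-] ->]]].
  exists (r *: dm b p q x), (r *: dm b p q y); split; last by rewrite scalerDr.
    exists (r *: x); last by rewrite linearZ.
    split=> // k; rewrite linearZ ffunE.
    by apply: Jn_mul => //; have [_] := hx; apply.
  exists (r *: y); last by rewrite linearZ.
  by move=> k; rewrite ffunE; exact: Jn_mul.
- move=> r n _ rI [y hy <-]; exists (r *: y); last by rewrite linearZ.
  by move=> k; rewrite ffunE; exact: Jn_mul.
- by move=> r rI; left.
- move=> n; have [k hk] := fin n; exists k.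
  apply/(lenle_corr (dm b p q : {linear vec (b p) M -> vec (b q) M}) k (hC n) (hTn n)).
  apply: lenle_sub hk => // v Bv; split; first exact: bnd_cycJ Bv.
  have [_ [r [[w _ <-] hr ->]]] := Bv; exists r => //.
  by rewrite linearD /= dmK add0r.
Qed.

Lemma psi_sum : exists r : seq int, forall n,
  psi M I X n = (\sum_(i <- r) hlen n (i - 1) i (i + 1))%N /\
  forall i, (hlen n (i - 1) i (i + 1) <= psi M I X n)%N.
Proof.
have [B [hB hB']] := bounded_above bX.
pose r := [seq k%:Z - B%:Z | k <- iota 0 (B + B).+1].
have ur : uniq r.
  by rewrite map_inj_uniq ?iota_uniq // => i j /(@addIr _ (- B%:Z)) [].
have out i n : i \notin r -> hlen n (i - 1) i (i + 1) = 0%N.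
  move=> ir; apply: len_eq0 => v _.
  have r0 : rk (b i) = 0%N.
    apply: rk_eq0 => x; have [iB|iB] := ltrP i (- B%:Z); first exact: hB'.
    have [Bi|Bi] := ltrP B%:Z i; first exact: hB.
    case/negP: ir; apply/mapP; exists (absz (i + B%:Z)); last by lia.
    by rewrite mem_iota; lia.
  have -> : v = 0 by apply/ffunP => k; have := ltn_ord k; rewrite {2}r0.
  exact: (submod0 (submod_bnd b (i - 1) i (submod_Jn n) (submodT M))).
have E n : psi M I X n = (\sum_(i <- r) hlen n (i - 1) i (i + 1))%N.
  rewrite /psi (fsbigE r) //; last by move=> i _ ir; rewrite cohomology_hlen out.
  rewrite big_mkcond; apply: eq_bigr => i _ /=.
  by rewrite in_setT cohomology_hlen.
exists r => n; split=> // i; rewrite E; have [ir|/out -> //] := boolP (i \in r).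
by rewrite (bigD1_seq i) //= leq_addr.
Qed.

Lemma psi_evpoly : evpoly (fun n => (psi M I X n)%:R).
Proof.
have [r hr] := psi_sum.
apply: (@evpoly_eq _ (fun n => \sum_(i <- r) (hlen n (i - 1) i (i + 1))%:R) 0%N).
  by move=> n _; have [-> _] := hr n; rewrite natr_sum.
by apply: evpoly_sum => i; apply: hlen_evpoly; rewrite ?subrK.
Qed.

Lemma coh_le_psi n : coh_le b (Jn n) setT (psi M I X n).
Proof.
move=> o p q eo eq; have [r hr] := psi_sum; have [_ le] := hr n.
have -> : o = p - 1 by rewrite eo addrK.
rewrite eq; have e1 : p = p - 1 + 1 by rewrite subrK.
by apply: (lenle_leq (le p)); exact: hlen_lenle.
Qed.

(** If [psi] vanished at [n + 1], then [coh_le_residue] would give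
    [M = I^(n+1) M + m M], and Nakayama's lemma [M = 0]. *)
Lemma psi_pos n : ~ homotopy_iso X (zero_complex A) -> (exists x : M, x != 0) ->
  ~ ((1 : A^o) \in I) -> (0 < psi M I X n.+1)%N.
Proof.
move=> nz [x x0] I1; rewrite lt0n; apply/negP => /eqP psi0.
have bd0 := @coh_le_psi n.+1; rewrite psi0 in bd0.
have [s hs] := fin_gen_span fM; have nM := noeth_fg hA hs.
have hT := submodT M; have hJ := submod_Jn n.+1.
have [cs hcs] := hA (submodClosedP m).
have hm' := submod_scalS (cs : seq A) hT.
have hU := submod_addS hJ hm'.
have mU (a : A) v : (a : A^o) \in m -> addS (Jn n.+1) (scalS (cs : seq A) setT) (a *: v).
  by move=> am; apply: addSr => //; apply: (@scalS_span _ _ cs) => //; rewrite -hcs.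
have TU : setT `<=` addS (Jn n.+1) (scalS (cs : seq A) setT).
  apply: (lenle0_sub hU hT) => //.
  apply: (coh_le_residue hA hm bX nX nz hJ hT _ hU _ _ bd0) => //; first exact: addSl.
  by move=> a v am _; exact: mU.
have Im c : c \in (gI : seq A) -> (c : A^o) \in m.
  move=> cI; have := local_proper hA hm (submodClosedP I) I1; apply.
  by have := @spanS_mem A A^o gI c cI; rewrite -hI.
suff /(_ x Logic.I) : setT `<=` [set (0 : M)] by move/eqP; rewrite (negPf x0).
apply: (nakayama hA hm nM hT (submod_set0 M)) => U' hU' _ mU'.
apply: subset_trans TU _; apply: addS_sub => //.
  by apply: scalS_sub => // c v /Im cm _; exact: mU'.
apply: scalS_sub => // c v cs' _; apply: mU' => //.
by have := @spanS_mem A A^o cs c cs'; rewrite -hcs.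
Qed.

End OneComplex.
End Psi.

(** * Degrees of polynomials and growth *)

Lemma poly_pos (p : {poly rat}) : 0 < lead_coef p ->
  exists2 e : rat, 0 < e & exists n0 : nat, forall n, (n0 <= n)%N -> e <= p.[n%:R].
Proof.
elim/poly_ind: p => [|p c IH]; first by rewrite lead_coef0 ltxx.
have [->|p0] := eqVneq p 0.
  rewrite mul0r add0r lead_coefC => c0; exists c => //.
  by exists 0%N => n _; rewrite hornerC.
have -> : lead_coef (p * 'X + c%:P) = lead_coef p.
  rewrite lead_coefDl ?lead_coefMX // size_mulX // size_polyC.
  by case: eqP => //=; rewrite ltnS size_poly_gt0.
move=> /IH[e e0 [n0 hn0]]; exists 1 => //.
exists (maxn n0 (Num.truncn ((1 + `|c|) / e)).+1) => n.
rewrite geq_max => /andP[/hn0 hp hn]; rewrite !hornerE.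
have h1 : (1 + `|c|) / e <= n%:R.
  apply: le_trans (ltW (truncnS_gt _)) _.
  by rewrite ler_nat.
rewrite ler_pdivrMr // in h1.
have h2 : n%:R * e <= p.[n%:R] * n%:R by rewrite mulrC ler_wpM2r.
rewrite -lerBlDr; apply: le_trans (le_trans h1 h2).
by rewrite lerD2l -normrN ler_norm.
Qed.

Lemma size_le_of_bound (p q : {poly rat}) (K : rat) n0 : 0 <= K ->
  (forall n, (n0 <= n)%N -> 0 <= p.[n%:R] <= K * q.[n%:R]) -> (size p <= size q)%N.
Proof.
move=> K0 h; rewrite leqNgt; apply/negP => qp.
have p0 : p != 0 by rewrite -size_poly_gt0; exact: leq_trans qp.
have neg (r : {poly rat}) : (forall n, (n0 <= n)%N -> 0 <= r.[n%:R]) -> ~ lead_coef r < 0.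
  move=> hr; rewrite -oppr_gt0 -lead_coefN => /poly_pos[e e0 [n1 h1]].
  have := lt_le_trans e0 (h1 (maxn n0 n1) (leq_maxr _ _)).
  by rewrite hornerN oppr_gt0 ltNge hr // leq_maxl.
have lp : 0 < lead_coef p.
  rewrite lt_def lead_coef_eq0 p0 leNgt; apply/negP; apply: neg => n /h.
  by case/andP.
apply: (neg (K *: q - p)).
  by move=> n /h /andP[_]; rewrite hornerD hornerN hornerZ subr_ge0.
rewrite addrC lead_coefDl ?lead_coefN ?oppr_lt0 //.
by rewrite size_polyN; apply: leq_ltn_trans (size_scale_leq _ _) qp.
Qed.

(** * The degree is independent of the complex *)

(** An object of K^b_f(proj A) with a basis of each of its terms, which are free
    because [A] is local. *)
Definition coordinatized (A : comNzRingType) (X : complex A)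
    (b : forall i, based (X i)) : Prop :=
  [/\ bounded X, forall i, noeth (X i) &
    forall i, exists L, lenle (imd X (i - 1) i) (kerd X i (i + 1)) L].

Lemma Kbf_coordinatized (A : comNzRingType) (m : submodClosed A^o) (X : complex A) :
  noeth A^o -> local_ring m -> Kbf_proj X ->
  exists b : forall i, based (X i), coordinatized b.
Proof.
move=> hA hm [[bX pX] fX].
have hb i : exists b : based (X i), True.
  by have [fg pr] := pX i; exact: (projective_based hA hm fg pr).
exists (fun i => sval (cid (hb i))); split=> // i.
  by have [/fin_gen_span[s hs] _] := pX i; exact: (noeth_fg hA hs).
by have [L hL] := finite_lengthE (fX i); exists L; apply/cohomology_lenle.
Qed.

Section Degree.
Variables (A : comNzRingType) (m : submodClosed A^o).
Hypotheses (hA : noeth A^o) (hm : local_ring m).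
Variables (M : lmodType A) (fM : fin_gen M) (I : submodClosed A^o) (gI : seq A^o).
Hypothesis hI : [set a | a \in I] = spanS gI.

Lemma psi_le (X Y : complex A) (bX : forall i, based (X i)) (bY : forall i, based (Y i)) :
  coordinatized bX -> coordinatized bY -> ~ homotopy_iso X (zero_complex A) ->
  exists K, forall n, (psi M I Y n <= K * psi M I X n)%N.
Proof.
move=> [boX nX fX] [boY nY fY] nz.
have [K hK] := comparison hA hm bX bY boX boY nX nY nz fY M.
have [r hr] := psi_sum M hI bY boY.
exists (size r * K)%N => n; have [-> _] := hr n.
have hJ := @submod_Jn _ M gI n.
have h i : (hlen M gI bY n (i - 1) i (i + 1) <= K * psi M I X n)%N.
  apply: len_le; first exact: (submod_bnd bY _ _ hJ (submodT M)).
    exact: bnd_cycJ.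
  apply: hK => //; last by rewrite subrK.
  exact: (coh_le_psi hA hm fM hI boX nX fX).
apply: leq_trans (leq_sum _ (fun i _ => h i)) _.
by rewrite big_const_seq count_predT iter_addn_0 mulnC mulnA.
Qed.

Lemma size_psi_poly (X Y : complex A)
    (bX : forall i, based (X i)) (bY : forall i, based (Y i))
    (p q : {poly rat}) n0 n1 :
  coordinatized bX -> coordinatized bY -> ~ homotopy_iso X (zero_complex A) ->
  (forall n, (n0 <= n)%N -> (psi M I X n)%:R = p.[n%:R]) ->
  (forall n, (n1 <= n)%N -> (psi M I Y n)%:R = q.[n%:R]) ->
  (size q <= size p)%N.
Proof.
move=> cX cY nz hp hq; have [K hK] := psi_le cX cY nz.
apply: (@size_le_of_bound _ _ K%:R (maxn n0 n1)); first exact: ler0n.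
move=> n; rewrite geq_max => /andP[h0 h1]; rewrite -hp // -hq // ler0n /=.
by rewrite -natrM ler_nat.
Qed.

End Degree.

Theorem theorem1p2 (A : comNzRingType) (m : submodClosed A^o)
    (hN : noetherian A) (hm : local_ring m)
    (M : lmodType A) (hM : fin_gen M) (hM0 : exists x : M, x != 0)
    (I : submodClosed A^o) (hI : ~ (I =i predT)) :
  exists r : nat, forall X : complex A,
    Kbf_proj X -> ~ homotopy_iso X (zero_complex A) ->
    polynomial_type_deg (fun n => (psi M I X n)%:Z) r.
Proof.
have hA := noetherian_noeth hN; have [gI hgI] := hA _ (submodClosedP I).
have I1 : ~ ((1 : A^o) \in I).
  move=> I1; apply: hI => x; rewrite inE -(mulr1 x).
  exact: (submodZ (x : A) (submodClosedP I) I1).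
have [[X0 [KX0 nz0]]|no] := pselect (exists X : complex A,
    Kbf_proj X /\ ~ homotopy_iso X (zero_complex A)); last first.
  by exists 0%N => X KX nz; case: no; exists X.
have [b0 c0] := Kbf_coordinatized hA hm KX0.
have [p0 [n0 hp0]] : evpoly (fun n => (psi M I X0 n)%:R).
  by have [bo nX fX] := c0; exact: (psi_evpoly hA hm hM hgI b0 bo nX fX).
exists (size p0).-1 => X KX nz.
have [b c] := Kbf_coordinatized hA hm KX.
have [p [n1 hp]] : evpoly (fun n => (psi M I X n)%:R).
  by have [bo nX fX] := c; exact: (psi_evpoly hA hm hM hgI b bo nX fX).
exists p; split; last by exists n1 => n /hp <-; rewrite pmulrn.
have -> : size p = size p0.
  apply/eqP; rewrite eqn_leq; apply/andP; split.
    exact: (size_psi_poly hA hm hM hgI c0 c nz0 hp0 hp).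
  exact: (size_psi_poly hA hm hM hgI c c0 nz hp hp0).
rewrite prednK // size_poly_gt0; apply/eqP => p00.
have [bo nX fX] := c0.
have := psi_pos hA hm hM hgI b0 bo nX fX n0 nz0 hM0 I1.
by rewrite -(ltr_nat rat) hp0 // p00 horner0 ltxx.
Qed.
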